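(* Let the system $(A,B,C,D)$ be externally symmetric with signature matrix $\Sigma_e$, let $Q\succeq0$, $R\succ0$, $t_f\in(0,\infty)$, $x_0\in\mathbb{R}^n$. Suppose the measurement noise satisfies the following: each noise process $\eta$ is square-integrable almost surely, i.e. $\mathbb{P}(\eta\in\mathcal{L}_2^m(0,t_f))=1$, and it has zero mean $\mathbb{E}(\eta(t))=0$ and a bounded variance $\Vert\mathrm{Cov}(\eta;t)\Vert_2\le\sigma^2<\infty$ for $t\in[0,t_f]$. Let $\alpha\in(0,\min\{\bar\alpha,1\})$, where $\bar\alpha=2/\bigl(\Vert R^{1/2}\mathcal{S}R^{-1/2}\Vert_{2,t_f}^2+1\bigr)$. Let $u_k$ be the nominal (noise-free) iterates $$u_{k+1}=(1-\alpha)u_k+\alpha\mathcal{T}(u_k),\qquad u_0\in\mathcal{L}_2^m(0,t_f),$$ let $\tilde u_k$ be the iterates under noisy measurements $$\tilde u_{k+1}=(1-\alpha)\tilde u_k+\alpha\tilde{\mathcal{T}}_k(\tilde u_k),$$ and write $\tilde u_k(t)=u_k(t)+\nu_k(t)$. Assume a deterministic initialization ($\nu_0=0$). Then the estimation $\tilde u_k=u_k+\nu_k$ is unbiased, i.e. $$\mathbb{E}(\nu_k)=0,\qquad k\in\mathbb{N},$$ and is of bounded variance.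
   Context: A prime denotes transpose. The system is $\frac{d}{dt}x=Ax+Bu$, $y=Cx+Du$ with $x(t)\in\mathbb{R}^n$, $u(t),y(t)\in\mathbb{R}^m$, real matrices $A,B,C,D$, and transfer function $G(s)=C(sI-A)^{-1}B+D$. A signature matrix is a diagonal matrix with diagonal entries in $\{-1,+1\}$. The system is externally symmetric with signature matrix $\Sigma_e\in\mathbb{R}^{m\times m}$ if $\Sigma_eG'(s)=G(s)\Sigma_e$. $Q,R\in\mathbb{R}^{m\times m}$ are symmetric. $\mathcal{L}_2^m(0,t_f)$ is the space of (classes of a.e. equal) measurable $u:[0,t_f]\to\mathbb{R}^m$ with $\Vert u\Vert_{2,t_f}=(\int_0^{t_f}\Vert u(t)\Vert_2^2dt)^{1/2}<\infty$; $\Vert\mathcal{K}\Vert_{2,t_f}$ is also the induced norm of a bounded linear operator. Define $\mathcal{J}u(t)=u(t_f-t)$, $\mathcal{G}u(t)=\int_0^tC\exp(A(t-\tau))Bu(\tau)d\tau+Du(t)$, $d_{x_0}(t)=C\exp(At)x_0$, with matrices acting pointwise on signals, and $$\mathcal{T}=-R^{-1}\Sigma_e\mathcal{J}\mathcal{G}\Sigma_eQ\mathcal{J}(\mathcal{G}+d_{x_0}),\qquad\mathcal{S}=-R^{-1}\Sigma_e\mathcal{J}\mathcal{G}\Sigma_eQ\mathcal{J}\mathcal{G},$$ where $(\mathcal{G}+d_{x_0})u$ means $\mathcal{G}u+d_{x_0}$. With noisy outputs $y=Cx+Du+\eta$, the operator $\mathcal{T}$ in iteration $k$ is replaced by $$\tilde{\mathcal{T}}_k=-R^{-1}\Sigma_e\mathcal{J}(\mathcal{G}+\eta_{2,k})\Sigma_eQ\mathcal{J}(\mathcal{G}+d_{x_0}+\eta_{1,k})=\mathcal{T}+\zeta_k,$$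 $$\zeta_k=-R^{-1}\Sigma_e\mathcal{J}\mathcal{G}\Sigma_eQ\mathcal{J}\eta_{1,k}-R^{-1}\Sigma_e\mathcal{J}\eta_{2,k},$$ where $\mathcal{G}+\eta_{2,k}$ denotes the map $v\mapsto\mathcal{G}v+\eta_{2,k}$, and $\eta_{1,k}$ and $\eta_{2,k}$ are independent measurement noises that appear in the first and second experiments with the system in iteration $k$. The components of $\eta(t)$ need not be independent of each other, and $\eta(t)$ need not be identically distributed over $t\in[0,t_f]$. $\mathrm{Cov}(\eta;t)$ is the covariance matrix at time $t$ of the random process $\eta$; ''bounded variance'' of a process is the phrase used in the noise hypothesis of the claim, i.e. boundedness of the norm of its covariance matrix for $t\in[0,t_f]$. $R^{1/2}$ is the principal square root. *)

(* Defs.v *)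
From HB Require Import structures.
From mathcomp Require Import all_boot all_order all_algebra.
From mathcomp Require Import all_classical all_reals all_analysis.
From mathcomp Require Import complex.

Set Implicit Arguments.
Unset Strict Implicit.
Unset Printing Implicit Defensive.

Import Order.TTheory GRing.Theory Num.Theory.
Import numFieldNormedType.Exports.

Local Open Scope classical_set_scope.
Local Open Scope ring_scope.

Section Matrices.
Variable R : realType.

Definition signature_mx m (S : 'M[R]_m) : Prop :=
  is_diag_mx S /\ forall i, S i i = 1 \/ S i i = -1.

Definition psdmx m (M : 'M[R]_m) : Prop :=
  M^T = M /\ forall v : 'cV[R]_m, 0 <= (v^T *m M *m v) 0 0.

Definition pdmx m (M : 'M[R]_m) : Prop :=
  M^T = M /\ forall v : 'cV[R]_m, v != 0 -> 0 < (v^T *m M *m v) 0 0.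

(* The principal square root of a positive semidefinite M is its unique
   positive semidefinite square root; the default 0 is only met when M is not
   positive semidefinite. *)
Definition sqrtmx m (M : 'M[R]_m) : 'M[R]_m :=
  xget 0 [set X : 'M[R]_m | psdmx X /\ X *m X = M].

Definition expmx n (M : 'M[R]_n) : 'M[R]_n :=
  limn (series (fun k : nat => k`!%:R^-1 *: M ^+ k)).

(* Euclidean norm; the library norm on matrices is the max norm. *)
Definition enorm m (v : 'cV[R]_m) : R := Num.sqrt (\sum_i v i 0 ^+ 2).

Definition mxnorm2 m p (M : 'M[R]_(m, p)) : R :=
  sup [set enorm (M *m v) | v in [set v : 'cV[R]_p | enorm v <= 1]].

End Matrices.

Record system (R : realType) (n m : nat) := System {
  sysA : 'M[R]_n;
  sysB : 'M[R]_(n, m);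
  sysC : 'M[R]_(m, n);
  sysD : 'M[R]_m }.

Section Systems.
Variables (R : realType) (n m : nat) (sys : system R n m).

Notation cmx M := (map_mx (real_complex R) M).

(* Meaningful where s is not an eigenvalue of A. *)
Definition transfer (s : R[i]) : 'M[R[i]]_m :=
  cmx (sysC sys) *m invmx (s%:M - cmx (sysA sys)) *m cmx (sysB sys)
  + cmx (sysD sys).

Definition externally_symmetric (Sig : 'M[R]_m) : Prop :=
  signature_mx Sig /\
  forall s : R[i], s%:M - cmx (sysA sys) \in unitmx ->
    cmx Sig *m (transfer s)^T = transfer s *m cmx Sig.

End Systems.

(* A signal on [0, tf] is represented by a function on R of which only the
   values on [0, tf] matter. *)
Notation signal R m := (R -> 'cV[R]_m).

Section Signals.
Variables (R : realType) (tf : R).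

Notation mu := (@lebesgue_measure R).

Definition L2sig m (u : signal R m) : Prop :=
  (forall i, measurable_fun `[0, tf] (fun t => u t i 0)) /\
  (\int[mu]_(t in `[0%R, tf]) ((enorm (u t) ^+ 2)%:E) < +oo)%E.

Definition L2norm m (u : signal R m) : R :=
  Num.sqrt (\int[mu]_(t in `[0, tf]) (enorm (u t) ^+ 2)).

Definition opnorm m p (K : signal R m -> signal R p) : R :=
  sup [set L2norm (K u) | u in [set u | L2sig u /\ L2norm u <= 1]].

Definition mxop m p (M : 'M[R]_(p, m)) (u : signal R m) : signal R p :=
  fun t => M *m u t.

Definition revop m (u : signal R m) : signal R m := fun t => u (tf - t).

Definition int_sig m (a b : R) (f : signal R m) : 'cV[R]_m :=
  \col_i \int[mu]_(t in `[a, b]) f t i 0.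

Section Operators.
Variables (n m : nat) (sys : system R n m).
Notation A := (sysA sys).
Notation B := (sysB sys).
Notation C := (sysC sys).
Notation D := (sysD sys).

Definition Gop (u : signal R m) : signal R m := fun t =>
  int_sig 0 t (fun tau => C *m expmx ((t - tau) *: A) *m B *m u tau) + D *m u t.

Definition free_response (x0 : 'cV[R]_n) : signal R m :=
  fun t => C *m expmx (t *: A) *m x0.

Variables (Sig Q W : 'M[R]_m).

(* W is the input weight, written R in the literature. *)
Definition Sop (u : signal R m) : signal R m :=
  mxop (- (invmx W *m Sig))
    (revop (Gop (mxop (Sig *m Q) (revop (Gop u))))).

Definition Top (x0 : 'cV[R]_n) (u : signal R m) : signal R m :=
  mxop (- (invmx W *m Sig))
    (revop (Gop (mxop (Sig *m Q) (revop (Gop u \+ free_response x0))))).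

(* eta1 and eta2 corrupt the outputs of the first and second experiment. *)
Definition Top_noisy (x0 : 'cV[R]_n) (eta1 eta2 u : signal R m) : signal R m :=
  mxop (- (invmx W *m Sig))
    (revop (Gop (mxop (Sig *m Q)
                   (revop (Gop u \+ free_response x0 \+ eta1)))
            \+ eta2)).

Definition alpha_bar : R :=
  2 / (opnorm (mxop (sqrtmx W) \o Sop \o mxop (invmx (sqrtmx W))) ^+ 2 + 1).

End Operators.
End Signals.

Section Processes.
Variables (d : measure_display) (T : measurableType d) (R : realType).
Variables (P : probability T R) (tf : R) (m : nat).

Notation process := (T -> signal R m).

Definition measurable_process (X : process) : Prop :=
  forall i, measurable_fun ([set: T] `*` `[0, tf])
    (fun z : T * measurableTypeR R => X z.1 z.2 i 0).

Definition zero_mean (X : process) : Prop :=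
  forall t, t \in `[0, tf] -> forall i, ('E_P[fun w => X w t i 0%R] = 0)%E.

(* Has real entries as soon as the components of X at time t are in L2(P);
   bounded_variance requires this. *)
Definition Cov (X : process) (t : R) : 'M[R]_m :=
  \matrix_(i, j) fine (covariance P (fun w => X w t i 0) (fun w => X w t j 0)).

Definition bounded_variance (X : process) (c : R) : Prop :=
  forall t, t \in `[0, tf] ->
    (forall i, (fun w => X w t i 0) \in Lfun P 2%:E) /\ mxnorm2 (Cov X t) <= c.

Definition sigma_process (X : process) : set (set T) :=
  <<s [set E | exists t i (S : set (measurableTypeR R)),
         [/\ t \in `[0, tf], measurable S
           & E = (fun w => X w t i 0) @^-1` S]] >>.

Definition independent_processes (X Y : process) : Prop :=
  forall E F, sigma_process X E -> sigma_process Y F ->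
    P (E `&` F) = (P E * P F)%E.

Definition measurement_noise (sigma : R) (eta : process) : Prop :=
  [/\ measurable_process eta,
      P [set w | L2sig tf (eta w)] = 1%E,
      zero_mean eta
    & bounded_variance eta (sigma ^+ 2)].

End Processes.

(* Main.v *)
Require Import Defs.
From HB Require Import structures.
From mathcomp Require Import all_boot all_order all_algebra.
From mathcomp Require Import all_classical all_reals all_analysis.
From mathcomp Require Import complex spectral measurable_realfun ring lra.

(** Why the estimate is unbiased and of bounded variance.

    Subtracting the nominal iteration from the noisy one cancels the free
    response and leaves a linear recursion for the error,
      nu_(k+1) = K nu_k + alpha zeta_k,   K = (1 - alpha) I + alpha S,
    in which zeta_k is a linear image of the two measurement noises.  K and the
    noise map are composed of constant matrices, time reversal and convolution
    with the impulse response.  Each of these maps a zero-mean process with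
    bounded second moments to a process of the same kind, by Fubini for the
    convolution ([second_order_volterra]), so every nu_k has zero mean and
    finite second moments.  What remains is a bound that is uniform in k.

    K is a strict contraction for the energy of W^(1/2) u.  In the time domain,
    external symmetry says that Sig D and Sig C exp(At) B are symmetric
    for all t ([markov_symmetric], [impulse_sym]).  Therefore reversing time on
    both sides of G and multiplying by Sig on both sides gives the adjoint
    of G ([volterra_adjoint]), W S = - G* Q G, and <u, W S u> <= 0
    ([Sop_passive]).  In the expansion of the energy of
    W^(1/2) ((1 - alpha) u + alpha S u) the mixed term can then be dropped,
    which leaves the factor rho = (1 - alpha)^2 + alpha^2 N^2 with N the
    operator norm of W^(1/2) S W^(-1/2); rho < 1 is exactly
    alpha < 2 / (N^2 + 1) ([relaxed_contraction]).

    This bounds the mean energy of nu_k, but the claim concerns each instant t.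
    S acts as a constant matrix plus integral operators whose values at every
    instant are bounded by the energy of their argument ([Sop_split]).  Testing
    the contraction on signals that live on a short interval [0, e], whose
    integral part is negligible, shows that the instantaneous matrix K0 of K
    contracts with the same rho ([contraction_instantaneous_part]).  Hence the
    weighted second moment of nu_k(t) obeys a contractive recursion as well, in
    which the already bounded mean energy and the noise enter as a bounded
    forcing term ([uniform_second_moment]).  In both recursions the triangle
    inequality is replaced by
      |a + b|^2 <= (1 + d) |a|^2 + (1 + 1/d) |b|^2,
    with d so small that (1 + d) rho < 1.

    Noise paths are square-integrable only almost surely, and the operators are
    linear only on square-integrable signals.  The error recursion is therefore
    studied for the processes set to zero outside the event on which all noise
    paths are square-integrable, which changes no expectation. *)

Set Implicit Arguments.
Unset Strict Implicit.
Unset Printing Implicit Defensive.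

Import Order.TTheory GRing.Theory Num.Theory.
Import numFieldNormedType.Exports.

Local Open Scope classical_set_scope.
Local Open Scope ring_scope.

(** * Euclidean norms and matrix square roots *)

Section LinearAlgebra.
Variable R : realType.

Definition sqn m (v : 'cV[R]_m) : R := \sum_i v i 0 ^+ 2.
Definition dotv m (u v : 'cV[R]_m) : R := \sum_i u i 0 * v i 0.
Definition sqfrob m p (M : 'M[R]_(m, p)) : R := \sum_i \sum_j M i j ^+ 2.

Lemma sqn_ge0 m (v : 'cV[R]_m) : 0 <= sqn v.
Proof. by apply: sumr_ge0 => i _; rewrite sqr_ge0. Qed.

Lemma sqfrob_ge0 m p (M : 'M[R]_(m, p)) : 0 <= sqfrob M.
Proof. by apply: sumr_ge0 => i _; apply: sumr_ge0 => j _; rewrite sqr_ge0. Qed.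

Lemma enorm_sqr m (v : 'cV[R]_m) : enorm v ^+ 2 = sqn v.
Proof. by rewrite sqr_sqrtr // sqn_ge0. Qed.

Lemma sqnE m (v : 'cV[R]_m) : sqn v = dotv v v.
Proof. by apply: eq_bigr => i _; rewrite expr2. Qed.

Lemma dotvE m (u v : 'cV[R]_m) : dotv u v = (u^T *m v) 0 0.
Proof. by rewrite mxE; apply: eq_bigr => i _; rewrite mxE. Qed.

Lemma dotv_mulmxl m p (M : 'M[R]_(m, p)) u v :
  dotv (M *m u) v = dotv u (M^T *m v).
Proof. by rewrite !dotvE trmx_mul mulmxA. Qed.

Lemma sqn0 m : sqn (0 : 'cV[R]_m) = 0.
Proof. by apply: big1 => i _; rewrite mxE expr0n. Qed.

Lemma sqnZ m a (v : 'cV[R]_m) : sqn (a *: v) = a ^+ 2 * sqn v.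
Proof. by rewrite mulr_sumr; apply: eq_bigr => i _; rewrite mxE exprMn. Qed.

Lemma sqnD m (u v : 'cV[R]_m) : sqn (u + v) = sqn u + 2 * dotv u v + sqn v.
Proof.
rewrite mulr_sumr -!big_split; apply: eq_bigr => i _ /=; rewrite mxE; ring.
Qed.

Lemma dotvZ m a b (u v : 'cV[R]_m) :
  dotv (a *: u) (b *: v) = a * b * dotv u v.
Proof. by rewrite mulr_sumr; apply: eq_bigr => i _; rewrite !mxE mulrACA. Qed.

Lemma sqr_le_sqn m (v : 'cV[R]_m) i : v i 0 ^+ 2 <= sqn v.
Proof.
by rewrite /sqn (bigD1 i) //= lerDl sumr_ge0 // => j _; rewrite sqr_ge0.
Qed.

(** With d small, the factor of the first term is as close to 1 as desired: this
    keeps a contraction factor below 1 when a perturbation is added. *)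
Lemma sqnD_le m d (u v : 'cV[R]_m) : 0 < d ->
  sqn (u + v) <= (1 + d) * sqn u + (1 + d^-1) * sqn v.
Proof.
move=> d0; rewrite !mulr_sumr -big_split; apply: ler_sum => i _ /=.
rewrite mxE; set a := u i 0; set b := v i 0; rewrite -subr_ge0.
have -> : (1 + d) * a ^+ 2 + (1 + d^-1) * b ^+ 2 - (a + b) ^+ 2 =
  d * (a - d^-1 * b) ^+ 2 by field; exact: lt0r_neq0.
by rewrite mulr_ge0 ?sqr_ge0 ?ltW.
Qed.

(** Lagrange's identity: the defect is half the sum of the squared 2 x 2 minors. *)
Lemma sum_cauchy_schwarz n (a b : 'I_n -> R) :
  (\sum_i a i * b i) ^+ 2 <= (\sum_i a i ^+ 2) * (\sum_i b i ^+ 2).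
Proof.
have : 0 <= \sum_i \sum_j (a i * b j - a j * b i) ^+ 2.
  by apply: sumr_ge0 => i _; apply: sumr_ge0 => j _; rewrite sqr_ge0.
suff -> : \sum_i \sum_j (a i * b j - a j * b i) ^+ 2 =
   ((\sum_i a i ^+ 2) * (\sum_i b i ^+ 2) - (\sum_i a i * b i) ^+ 2) *+ 2.
  by rewrite pmulrn_lge0 // subr_ge0.
rewrite mulr2n {1}(mulrC (\sum_i a i ^+ 2)) addrACA -opprD expr2.
rewrite !big_distrlr /= -!big_split -sumrB; apply: eq_bigr => i _ /=.
rewrite -!big_split -sumrB; apply: eq_bigr => j _ /=; ring.
Qed.

Lemma sqn_mulmx m p (M : 'M[R]_(m, p)) v : sqn (M *m v) <= sqfrob M * sqn v.
Proof.
rewrite /sqfrob mulr_suml; apply: ler_sum => i _; rewrite mxE.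
exact: sum_cauchy_schwarz.
Qed.

Lemma interpolation (K : fieldType) (f : K -> K) (s : seq K) :
  exists p : {poly K}, forall x, x \in s -> p.[x] = f x.
Proof.
elim: s => [|a s [p ps]]; first by exists 0.
have [as_|nas] := boolP (a \in s).
  by exists p => x; rewrite inE => /predU1P[->|]; [exact: ps|exact: ps].
pose q := \prod_(b <- s) ('X - b%:P).
have qa : q.[a] != 0.
  by rewrite -rootE root_prod_XsubC.
exists (p + ((f a - p.[a]) / q.[a])%:P * q) => x.
rewrite inE !hornerE => /predU1P[->|xs]; first by rewrite divfK // addrC subrK.
have /rootP -> : root q x by rewrite root_prod_XsubC.
by rewrite mulr0 addr0 ps.
Qed.

Lemma real_complex_ofR (x : R) : real_complex R x \is Num.real.
Proof. by rewrite complex_real. Qed.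

Lemma eigenvalue_psdmx m (W : 'M[R]_m) a : psdmx W -> eigenvalue W a -> 0 <= a.
Proof.
move=> [_ Wge0] /eigenvalueP[v vW vn0].
have := Wge0 v^T; rewrite trmxK vW -scalemxAl mxE.
have vv : (v *m v^T) 0 0 = sqn v^T by rewrite sqnE dotvE trmxK.
rewrite vv pmulr_lge0 // lt0r sqn_ge0 andbT.
apply: contraNneq vn0 => s0; apply/eqP/rowP => j; rewrite mxE.
apply/eqP; rewrite -sqrf_eq0 eq_le sqr_ge0 andbT -s0.
by have := sqr_le_sqn v^T j; rewrite mxE.
Qed.

(** A real polynomial q that takes the value x^(1/4) at every eigenvalue x of W
    yields the square root q(W)^2.  It is real and symmetric because q is a real
    polynomial, it is positive semidefinite as the square of a symmetric matrix,
    and q(W)^4 = W can be checked after complexification, where W is unitarily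
    diagonalizable. *)
Lemma psdmx_sqrt_exists m (W : 'M[R]_m) : psdmx W ->
  exists X : 'M[R]_m, psdmx X /\ X *m X = W.
Proof.
case: m W => [|m] W Wpsd.
  exists W; split=> //.
  by apply/matrixP => -[].
pose c := real_complex R.
pose Wc := map_mx c W.
have Wherm : Wc \is hermsymmx.
  apply: realsym_hermsym.
    by apply/is_hermitianmxP; rewrite expr0 scale1r map_mx_id // /Wc map_trmx Wpsd.1.
  by apply/mxOverP => i j; rewrite mxE real_complex_ofR.
have /orthomx_spectralP := hermitian_normalmx Wherm.
set P := spectralmx Wc; set dg := spectral_diag Wc => WE.
have Pu : P \in unitmx by exact: spectral_unit.
have dge0 i : exists2 x : R, dg 0 i = c x & 0 <= x.
  have eig : eigenvalue Wc (dg 0 i).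
    apply/eigenvalueP; exists (row i P).
      by rewrite -row_mul {1}WE !mulmxA mulmxV // mul1mx row_mul row_diag_mx
        -scalemxAl -rowE.
    apply/eqP => r0.
    have : row i (P *m invmx P) = 0 by rewrite row_mul r0 mul0mx.
    rewrite mulmxV // => /rowP/(_ i); rewrite !mxE eqxx => /eqP.
    by rewrite oner_eq0.
  have /mxOverP/(_ 0 i)/RRe_real := hermitian_spectral_diag_real Wherm.
  rewrite -/dg => dE.
  exists (complex.Re (dg 0 i)); first by rewrite -dE.
  apply: (@eigenvalue_psdmx _ W) => //.
  move: eig; rewrite !eigenvalue_root_char -dE /Wc -map_char_poly.
  by rewrite /= fmorph_root.
have [q qE] := interpolation (fun x : R => Num.sqrt (Num.sqrt x))
  [seq complex.Re (dg 0 i) | i <- enum 'I_m.+1].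
(* The eigenvalues of the complexified W are real, so interpolation over R
   suffices. *)
have qdg i : (map_poly c q).[dg 0 i] ^+ 4 = dg 0 i.
  have [x xE x0] := dge0 i.
  rewrite xE horner_map -rmorphXn; congr (c _).
  rewrite qE; last by apply/mapP; exists i; rewrite ?mem_enum // xE.
  by rewrite (exprM _ 2 2) !sqr_sqrtr // sqrtr_ge0.
pose X := horner_mx W q.
have hmul (p r : {poly R}) : horner_mx W (p * r) = horner_mx W p *m horner_mx W r.
  by rewrite rmorphM.
have hT (p : {poly R}) : (horner_mx W p)^T = horner_mx W p.
  elim/poly_ind: p => [|p a IH]; first by rewrite rmorph0 trmx0.
  rewrite rmorphD rmorphM /= horner_mx_X horner_mx_C linearD /=.
  rewrite tr_scalar_mx -mulmxE trmx_mul IH Wpsd.1; congr (_ + _).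
  by rewrite -{1 4}[W]horner_mx_X -!hmul mulrC.
have XX4 : horner_mx W (q ^+ 4) = W.
  apply: (@map_mx_inj _ _ c).
  rewrite map_horner_mx -/Wc WE.
  rewrite horner_mx_uconjC; last by [].
  congr (_ *m _ *m _); rewrite horner_mx_diag; congr diag_mx.
  by apply/rowP => i; rewrite mxE rmorphXn /= horner_exp qdg.
exists (horner_mx W (q ^+ 2)); split; last by rewrite -hmul -exprD.
split; first exact: hT.
move=> v; rewrite expr2 hmul -{1}(hT q) mulmxA -mulmxA -trmx_mul -dotvE -sqnE.
exact: sqn_ge0.
Qed.

Lemma sqrtmxP m (W : 'M[R]_m) : psdmx W ->
  psdmx (sqrtmx W) /\ sqrtmx W *m sqrtmx W = W.
Proof.
move=> /psdmx_sqrt_exists[X HX].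
exact: (@xgetPex _ 0 [set X : 'M[R]_m | psdmx X /\ X *m X = W] (ex_intro _ X HX)).
Qed.

Lemma pdmx_psdmx m (W : 'M[R]_m) : pdmx W -> psdmx W.
Proof.
move=> [WT Wpos]; split=> // v; have [->|v0] := eqVneq v 0.
  by rewrite mulmx0 mxE.
exact/ltW/Wpos.
Qed.

(** A nonzero row of the kernel would be a vector on which the form vanishes. *)
Lemma pdmx_unit m (W : 'M[R]_m) : pdmx W -> W \in unitmx.
Proof.
move=> [WT Wpos]; rewrite -row_free_unit -kermx_eq0.
apply/eqP/row_matrixP => i; rewrite row0; apply/eqP.
apply: contraT => r0.
have := Wpos (row i (kermx W))^T; rewrite trmx_eq0 => /(_ r0).
have rW0 : row i (kermx W) *m W = 0 by rewrite -row_mul mulmx_ker row0.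
by rewrite trmxK rW0 mul0mx mxE ltxx.
Qed.

End LinearAlgebra.

(** * External symmetry in the time domain *)

Section Markov.
Variable R : realType.

Lemma poly_eq0_horner (p : {poly R}) : (forall x, p.[x] = 0) -> p = 0.
Proof.
move=> p0; apply/eqP; apply: contraT => pn0.
have := @max_poly_roots R p [seq i%:R | i <- iota 0 (size p)] pn0.
rewrite size_map size_iota ltnn => -> //.
  by apply/allP => x _; rewrite rootE p0.
by rewrite map_inj_uniq ?iota_uniq // => i j /eqP; rewrite eqr_nat => /eqP.
Qed.

Section Resolvent.
Variables (n : nat) (A : 'M[R]_n.+1).

(** Coefficient of s^k in the adjugate of sI - A (Faddeev-LeVerrier): the
    resolvent is the quotient of this matrix polynomial by the characteristic
    polynomial. *)
Definition adj_coef k : 'M[R]_n.+1 :=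
  \matrix_(i, j) (\adj (char_poly_mx A) i j)`_k.

(** Coefficient of s^k in adj(sI - A) (sI - A) = char_poly(s) I. *)
Lemma adj_coef_rec k :
  (if k is l.+1 then adj_coef l else 0) = adj_coef k *m A + ((char_poly A)`_k)%:M.
Proof.
have /matrixP H := mul_adj_mx (char_poly_mx A).
apply/matrixP => i j; have := congr1 (fun p : {poly R} => p`_k) (H i j).
rewrite /char_poly_mx mulmxBr mul_mx_scalar !mxE coefB coefXM coef_sum.
rewrite (eq_bigr (fun l => adj_coef k i l * A l j)); last first.
  by move=> l _; rewrite [adj_coef k i l]mxE [map_mx _ _ l j]mxE coefMC.
rewrite coefMn -/(char_poly_mx A) -/(char_poly A) => /eqP; rewrite subr_eq.
by move=> /eqP; rewrite addrC; case: k => [|k] /= <-; rewrite ?mxE.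
Qed.

(** By the recursion, a coefficient of index greater than n is the next one times A, and all
    coefficients vanish from some index on: descend from there. *)
Lemma adj_coef_large k : (n < k)%N -> adj_coef k = 0.
Proof.
pose sz (ij : 'I_n.+1 * 'I_n.+1) := size (\adj (char_poly_mx A) ij.1 ij.2).
pose K := (\sum_ij sz ij)%N.
suff H d : forall l, (n < l)%N -> (K <= l + d)%N -> adj_coef l = 0.
  by move=> nk; apply: (H K) => //; rewrite leq_addl.
elim: d => [|d IH] l nl Kl.
  apply/matrixP => i j; rewrite mxE [RHS]mxE nth_default //.
  rewrite addn0 in Kl; apply: leq_trans Kl.
  by rewrite /K (bigD1 (i, j)) //= leq_addr.
have := adj_coef_rec l.+1 => /= ->.
rewrite IH ?addSnnS //; last by rewrite ltnS ltnW.
rewrite mul0mx add0r nth_default ?size_char_poly ?ltnS //.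
by apply/matrixP => i j; rewrite !mxE mul0rn.
Qed.

Lemma adj_coef_lead : adj_coef n = 1%:M.
Proof.
have := adj_coef_rec n.+1 => /= ->.
rewrite adj_coef_large // mul0mx add0r; congr (_%:M).
have /monicP := char_poly_monic A.
by rewrite /lead_coef size_char_poly.
Qed.

Lemma char_poly_mx_horner s :
  s%:M - A = map_mx (horner_eval s) (char_poly_mx A).
Proof.
apply/matrixP => i j; rewrite !mxE /horner_eval !hornerE.
by rewrite hornerMn hornerX.
Qed.

Lemma adj_resolvent s :
  \adj (s%:M - A) = \sum_(k < n.+1) s ^+ k *: adj_coef k.
Proof.
rewrite char_poly_mx_horner.
rewrite -map_mx_adj; apply/matrixP => i j; rewrite mxE summxE.
rewrite /= /horner_eval (@horner_coef_wide _ n.+1).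
  by apply: eq_bigr => k _; rewrite [RHS]mxE [in RHS]mxE mulrC.
apply/leq_sizeP => k nk; have /matrixP/(_ i j) := adj_coef_large nk.
by rewrite mxE [RHS]mxE.
Qed.

Lemma det_resolvent s : \det (s%:M - A) = (char_poly A).[s].
Proof.
by rewrite char_poly_mx_horner det_map_mx.
Qed.

End Resolvent.

Section Symmetry.
Variables (n m : nat) (A : 'M[R]_n) (B : 'M[R]_(n, m)) (C : 'M[R]_(m, n)).
Variable (Sig : 'M[R]_m).

(** Deviation of C M B from external symmetry.  It is linear in M, so it can be
    taken through polynomials and limits in A. *)
Definition sym_defect (M : 'M[R]_n) : 'M[R]_m :=
  Sig *m (C *m M *m B)^T - C *m M *m B *m Sig.

Lemma sym_defect_is_linear : linear sym_defect.
Proof.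
move=> a M N; rewrite /sym_defect !mulmxDr !mulmxDl -!scalemxAr -!scalemxAl.
rewrite linearD linearZ /= mulmxDr -scalemxAr scalerBr opprD.
by rewrite addrACA.
Qed.

HB.instance Definition _ :=
  GRing.isLinear.Build R 'M[R]_n 'M[R]_m *:%R sym_defect sym_defect_is_linear.

End Symmetry.

(** Write L for [sym_defect], L_D for the same defect of D, N_k for the
    coefficients of adj(sI - A) and c_k for those of the characteristic
    polynomial.  Multiplied by the characteristic polynomial, the symmetry of
    the transfer function becomes the polynomial identity
      sum_k s^k (L(N_k) + c_k L_D) = 0.
    The leading coefficient gives L_D = 0, hence L(N_k) = 0 for all k.  The
    relation N_k A^(j+1) = (N_(k-1) - c_k I) A^j then carries L(N_k A^j) = 0 from
    j to j + 1, because the leading N is the identity. *)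
Lemma markov_symmetric n m (sys : system R n m) (Sig : 'M[R]_m) :
  externally_symmetric sys Sig ->
  Sig *m (sysD sys)^T = sysD sys *m Sig /\
  forall j, sym_defect (sysB sys) (sysC sys) Sig (sysA sys ^+ j) = 0.
Proof.
case: sys => A B C D [_ /=]; rewrite /transfer /= => sym.
have [LD LDE] : {LD | LD = Sig *m D^T - D *m Sig} by exists (Sig *m D^T - D *m Sig).
have symR s : s%:M - A \in unitmx -> sym_defect B C Sig (invmx (s%:M - A)) + LD = 0.
  move=> su; have cE : (real_complex R s)%:M - map_mx (real_complex R) A =
      map_mx (real_complex R) (s%:M - A).
    by rewrite map_mxB map_scalar_mx.
  have := sym (real_complex R s); rewrite cE map_unitmx => /(_ su).
  rewrite -map_invmx -!map_mxM -map_mxD map_trmx -!map_mxM.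
  move=> /map_mx_inj H; rewrite LDE /sym_defect addrACA -opprD -mulmxDr -mulmxDl.
  by rewrite -linearD /= H subrr.
case: n A B C sym symR => [|n] A B C _ symR.
  have aE M : sym_defect B C Sig M = 0.
    by rewrite /sym_defect [C]thinmx0 !mul0mx trmx0 mulmx0 subrr.
  split=> [|j]; last exact: aE.
  have /symR : 0%:M - A \in unitmx by rewrite unitmxE det_mx00 unitr1.
  by rewrite aE add0r LDE => /eqP; rewrite subr_eq0 => /eqP.
pose c k := sym_defect B C Sig (adj_coef A k) + (char_poly A)`_k *: LD.
have c0 k : c k = 0.
  have [kn|nk] := leqP k n.+1; last first.
    rewrite /c adj_coef_large 1?ltnW // linear0 nth_default ?scale0r ?addr0 //.
    by rewrite size_char_poly.
  apply/matrixP => i j.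
  pose p := \poly_(k < n.+2) c k i j.
  suff p0 : p = 0.
    have := coef_poly n.+2 (fun k => c k i j) k.
    by rewrite -/p p0 coef0 ltnS kn => <-; rewrite mxE.
  (* The symmetry is only known off the spectrum; the factor char_poly A makes
     the identity hold at every real s. *)
  suff : p * char_poly A = 0.
    by move/eqP; rewrite mulf_eq0 (negbTE (monic_neq0 (char_poly_monic A))) orbF => /eqP.
  apply: poly_eq0_horner => s; rewrite hornerM.
  have [->|dn0] := eqVneq (char_poly A).[s] 0; first by rewrite mulr0.
  have su : s%:M - A \in unitmx by rewrite unitmxE det_resolvent unitfE.
  suff -> : p.[s] = 0 by rewrite mul0r.
  have -> : p.[s] = (\sum_(k < n.+2) s ^+ k *: c k) i j.
    rewrite horner_poly summxE; apply: eq_bigr => l _.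
    by rewrite [RHS]mxE mulrC.
  suff -> : \sum_(k < n.+2) s ^+ k *: c k = (char_poly A).[s] *:
     (sym_defect B C Sig (invmx (s%:M - A)) + LD) by rewrite symR // scaler0 mxE.
  rewrite /c; under eq_bigr do rewrite scalerDr scalerA -linearZ.
  rewrite big_split /= -linear_sum -scaler_suml scalerDr -linearZ; congr (_ + _).
    congr sym_defect; rewrite big_ord_recr /= adj_coef_large // scaler0 addr0.
    by rewrite -adj_resolvent /invmx su -det_resolvent scalerA mulfV ?scale1r //
      det_resolvent.
  congr (_ *: _); rewrite (@horner_coef_wide _ n.+2) ?size_char_poly //.
  by apply: eq_bigr => l _; rewrite mulrC.
have LD0 : LD = 0.
  have := c0 n.+1; rewrite /c adj_coef_large // linear0 add0r.
  have /monicP := char_poly_monic A.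
  by rewrite /lead_coef size_char_poly /= => ->; rewrite scale1r.
split; first by apply/eqP; rewrite -subr_eq0 -LDE; apply/eqP.
suff H j k : sym_defect B C Sig (adj_coef A k *m A ^+ j) = 0.
  by move=> j; have := H j n; rewrite adj_coef_lead mul1mx.
elim: j k => [|j IH] k.
  by have := c0 k; rewrite /c LD0 scaler0 addr0 expr0 mulmx1.
have -> : adj_coef A k *m A ^+ j.+1 =
   (if k is l.+1 then adj_coef A l *m A ^+ j else 0)
   - (char_poly A)`_k *: (adj_coef A n *m A ^+ j).
  rewrite adj_coef_lead mul1mx exprS -[A * _]/(A *m _) mulmxA.
  have -> : adj_coef A k *m A =
      (if k is l.+1 then adj_coef A l else 0) - ((char_poly A)`_k)%:M.
    by rewrite adj_coef_rec addrK.
  by rewrite mulmxBl mul_scalar_mx; case: k => [|k] //; rewrite mul0mx.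
rewrite linearB linearZ /= IH scaler0 subr0.
by case: k => [|k]; rewrite ?linear0 ?IH.
Qed.

End Markov.

(** * The matrix exponential *)

Section MatrixExponential.
Variable R : realType.

(** A submultiplicative norm, so that the exponential series is dominated entry
    by entry by the scalar series of exp (entry_sum M). *)
Definition entry_sum n p (M : 'M[R]_(n, p)) : R := \sum_i \sum_j `|M i j|.

Lemma entry_sum_ge0 n p (M : 'M[R]_(n, p)) : 0 <= entry_sum M.
Proof. by apply: sumr_ge0 => i _; apply: sumr_ge0 => j _. Qed.

Lemma entry_sumZ n p a (M : 'M[R]_(n, p)) :
  entry_sum (a *: M) = `|a| * entry_sum M.
Proof.
rewrite mulr_sumr; apply: eq_bigr => i _; rewrite mulr_sumr.
by apply: eq_bigr => j _; rewrite mxE normrM.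
Qed.

Lemma mxpow_entry_le n (M : 'M[R]_n) k i j :
  `|(M ^+ k) i j| <= entry_sum M ^+ k.
Proof.
elim: k i j => [|k IH] i j.
  by rewrite !expr0 mxE; case: (i == j); rewrite ?normr1 // normr0.
rewrite !exprS mxE (le_trans (ler_norm_sum _ _ _)) //.
have -> : entry_sum M * entry_sum M ^+ k =
    \sum_p \sum_q `|M p q| * entry_sum M ^+ k.
  by rewrite mulr_suml; apply: eq_bigr => p _; rewrite mulr_suml.
rewrite [leRHS](bigD1 i) //= -[leLHS]addr0 lerD //.
  by apply: ler_sum => l _; rewrite normrM ler_wpM2l.
apply: sumr_ge0 => p _; apply: sumr_ge0 => q _.
by rewrite mulr_ge0 // exprn_ge0 // entry_sum_ge0.
Qed.

Lemma mxpowZ n a (M : 'M[R]_n) k : (a *: M) ^+ k = a ^+ k *: M ^+ k.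
Proof.
elim: k => [|k IH]; first by rewrite !expr0 scale1r.
by rewrite !exprS IH -!mulmxE -scalemxAl -scalemxAr scalerA.
Qed.

Definition exp_term n (M : 'M[R]_n) (k : nat) : 'M[R]_n := k`!%:R^-1 *: M ^+ k.

Lemma exp_term_entry_le n (M : 'M[R]_n) k i j :
  `|exp_term M k i j| <= exp_coeff (entry_sum M) k.
Proof.
rewrite mxE normrM ger0_norm ?invr_ge0 ?ler0n // /exp_coeff mulrC.
by rewrite ler_wpM2r ?invr_ge0 ?ler0n // mxpow_entry_le.
Qed.

Lemma series_mxE n (u : nat -> 'M[R]_n) N i j :
  (series u N) i j = series (fun k => u k i j) N.
Proof. by rewrite /series /= summxE. Qed.

Lemma normed_exp_entry_cvg n (M : 'M[R]_n) i j :
  cvgn [normed series (fun k => exp_term M k i j)].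
Proof.
apply: series_le_cvg (is_cvg_series_exp_coeff (entry_sum M)) => k /=.
- exact: normr_ge0.
- exact/exp_coeff_ge0/entry_sum_ge0.
- exact: exp_term_entry_le.
Qed.

Lemma cvg_expmx n (M : 'M[R]_n) : series (exp_term M) @ \oo --> expmx M.
Proof.
suff : cvgn (series (exp_term M)) by [].
pose l : 'M[R]_n := \matrix_(i, j) limn (series (fun k => exp_term M k i j)).
apply/cvg_ex; exists l; apply/cvg_ballP => e e0.
suff : \forall N \near \oo, forall i j, ball (l i j) e (series (exp_term M) N i j).
  by apply: filterS => N; rewrite ?/ball /=.
apply: filter_forall => i; apply: filter_forall => j.
have /cvg_ballP/(_ _ e0) := normed_cvg (@normed_exp_entry_cvg n M i j).
by apply: filterS => N; rewrite series_mxE mxE.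
Qed.

Lemma cvg_expmx_entry n (M : 'M[R]_n) i j :
  series (fun k => exp_term M k i j) @ \oo --> expmx M i j.
Proof.
have := cvg_comp _ _ (@cvg_expmx n M) (@coord_continuous R n n i j (expmx M)).
have -> : series (fun k => exp_term M k i j) =
    (fun N => (series (exp_term M) N) i j).
  by apply/funext => N; rewrite series_mxE.
exact.
Qed.

Lemma cvg_expmx_linear n (M : 'M[R]_n) (f : {linear 'M[R]_n -> R}) :
  (fun N => f (series (exp_term M) N)) @ \oo --> f (expmx M).
Proof.
have fE X : f X = \sum_i \sum_j X i j * f (delta_mx i j).
  rewrite {1}[X]matrix_sum_delta linear_sum; apply: eq_bigr => i _.
  by rewrite linear_sum; apply: eq_bigr => j _; rewrite linearZ.
rewrite fE; under eq_fun do rewrite fE.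
apply: (@cvg_big _ _ +%R 0 xpredT add_continuous) => i _.
apply: (@cvg_big _ _ +%R 0 xpredT add_continuous) => j _.
apply: cvgMl; under eq_fun do rewrite series_mxE.
exact: cvg_expmx_entry.
Qed.

(** The exponential is a limit of polynomials in M, and linear forms on matrices
    are continuous. *)
Lemma expmx_linear_eq0 n (M : 'M[R]_n) (f : {linear 'M[R]_n -> R}) :
  (forall k, f (M ^+ k) = 0) -> f (expmx M) = 0.
Proof.
move=> f0; rewrite -(cvg_lim (@Rhausdorff R) (@cvg_expmx_linear n M f)).
apply: (cvg_lim (@Rhausdorff R)); apply: cvg_near_cst; near=> N.
rewrite /series /= linear_sum big1 // => k _.
by rewrite linearZ /= f0 scaler0.
Unshelve. all: by end_near.
Qed.

Lemma measurable_expmx_entry n (M : 'M[R]_n) i j :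
  measurable_fun [set: R] (fun t => expmx (t *: M) i j).
Proof.
pose h N (t : measurableTypeR R) : R := series (fun k => exp_term (t *: M) k i j) N.
apply: (@measurable_realfun.measurable_fun_cvg _ _ R setT h); last first.
  by move=> t _; exact: cvg_expmx_entry.
move=> N; rewrite /h /series /=.
apply: measurable_sum => k.
have -> : (fun t => exp_term (t *: M) k i j) =
    (fun t : R => t ^+ k * (k`!%:R^-1 * (M ^+ k) i j)).
  by apply/funext => t; rewrite /exp_term mxpowZ !mxE mulrCA.
by apply: measurable_funM => //; exact: measurable_funX.
Qed.

Lemma expmx_entry_bounded n (M : 'M[R]_n) (T : R) :
  exists c, forall t, `|t| <= T -> forall i j, `|expmx (t *: M) i j| <= c.
Proof.
exists (limn (series (exp_coeff (T * entry_sum M)))) => t tT i j.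
have c1 := @cvg_expmx_entry n (t *: M) i j.
rewrite -(cvg_lim (@Rhausdorff R) c1).
have c2 : cvgn [normed series (fun k => exp_term (t *: M) k i j)].
  exact: normed_exp_entry_cvg.
apply: le_trans (lim_series_norm c2) _.
apply: lim_series_le => //; first exact: is_cvg_series_exp_coeff.
move=> k /=; apply: le_trans (exp_term_entry_le _ _ _ _) _.
rewrite /exp_coeff ler_wpM2r ?invr_ge0 ?ler0n //.
rewrite lerXn2r ?nnegrE ?entry_sum_ge0 ?mulr_ge0 ?entry_sum_ge0 //.
  exact: le_trans tT.
by rewrite entry_sumZ ler_wpM2r // entry_sum_ge0.
Qed.

End MatrixExponential.

(** * Square-integrable functions *)

Section SquareIntegrable.
Context d (T : measurableType d) (R : realType).
Variables (mu : {measure set T -> \bar R}) (D : set T).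
Hypothesis mD : measurable D.

Definition sq_integrable (f : T -> R) : Prop :=
  measurable_fun D f /\ (\int[mu]_(x in D) (f x ^+ 2)%:E < +oo)%E.

Lemma sq_integrable_sqr f : sq_integrable f ->
  mu.-integrable D (EFin \o (fun x => f x ^+ 2)).
Proof.
move=> [mf foo]; apply/integrableP; split.
  by apply/measurable_EFinP; exact: measurable_funX.
under eq_integral do rewrite /= ger0_norm ?sqr_ge0 //.
exact: foo.
Qed.

Lemma sq_integrableM f g : sq_integrable f -> sq_integrable g ->
  mu.-integrable D (EFin \o (fun x => f x * g x)).
Proof.
move=> Hf Hg; have := integrableD mD (sq_integrable_sqr Hf) (sq_integrable_sqr Hg).
apply: le_integrable => //.
  by apply/measurable_EFinP; apply: measurable_funM; [exact: Hf.1|exact: Hg.1].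
move=> x _ /=; rewrite lee_fin; set a := f x; set b := g x.
rewrite [leRHS]ger0_norm ?addr_ge0 ?sqr_ge0 // normrM.
rewrite -(real_normK (num_real a)) -(real_normK (num_real b)).
have := sqr_ge0 (`|a| - `|b|); have := normr_ge0 a; have := normr_ge0 b.
nra.
Qed.

Lemma sq_integrableD f g : sq_integrable f -> sq_integrable g ->
  sq_integrable (fun x => f x + g x).
Proof.
move=> Hf Hg; have mfg : measurable_fun D (fun x => f x + g x).
  by apply: measurable_funD; [exact: Hf.1|exact: Hg.1].
split=> //.
suff : mu.-integrable D (EFin \o (fun x => (f x + g x) ^+ 2)).
  move=> /integrableP[_]; apply: le_lt_trans.
  rewrite le_eqVlt; apply/orP; left; apply/eqP.
  by apply: eq_integral => x _ /=; rewrite ger0_norm ?sqr_ge0.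
have := integrableD mD (integrableZl mD 2 (sq_integrable_sqr Hf))
  (integrableZl mD 2 (sq_integrable_sqr Hg)).
apply: le_integrable => //.
  by apply/measurable_EFinP; exact: measurable_funX.
move=> x _ /=; rewrite lee_fin; set a := f x; set b := g x.
have a0 := sqr_ge0 a; have b0 := sqr_ge0 b.
rewrite [leLHS]ger0_norm ?sqr_ge0 // [leRHS]ger0_norm; last by lra.
by have := sqr_ge0 (a - b); lra.
Qed.

Lemma integrable_const (c : R) : (mu D < +oo)%E ->
  mu.-integrable D (EFin \o (fun=> c)).
Proof.
move=> muD; apply/integrableP; split; first exact/measurable_EFinP.
by under eq_integral do rewrite /=; rewrite integral_cst // lte_mul_pinfty.
Qed.

Lemma sq_integrable_integrable f : (mu D < +oo)%E -> sq_integrable f ->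
  mu.-integrable D (EFin \o f).
Proof.
move=> muD Hf; have := integrableD mD (sq_integrable_sqr Hf)
  (integrable_const 1 muD).
apply: le_integrable => //; first by apply/measurable_EFinP; exact: Hf.1.
move=> x _ /=; rewrite lee_fin; set a := f x.
rewrite [leRHS]ger0_norm ?addr_ge0 ?sqr_ge0 // -(real_normK (num_real a)).
by have := sqr_ge0 (`|a| - 1); have := normr_ge0 a; nra.
Qed.

(** Cauchy-Schwarz against a constant: expand the integral of (f - H / c)^2 >= 0,
    where H is the integral of f. *)
Lemma sqr_Rintegral_le f (c : R) : 0 < c -> (mu D <= c%:E)%E -> sq_integrable f ->
  (((\int[mu]_(x in D) f x) ^+ 2)%:E <= c%:E * \int[mu]_(x in D) (f x ^+ 2)%:E)%E.
Proof.
move=> c0 muDc Hf.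
have muD : (mu D < +oo)%E by apply: le_lt_trans muDc _; rewrite ltry.
have if1 := sq_integrable_integrable muD Hf.
have if2 := sq_integrable_sqr Hf.
set H := \int[mu]_(x in D) f x.
have <- : (\int[mu]_(x in D) (f x ^+ 2))%:E = (\int[mu]_(x in D) (f x ^+ 2)%:E)%E.
  by rewrite /Rintegral fineK //; exact: integrable_fin_num.
set S := \int[mu]_(x in D) (f x ^+ 2).
rewrite -EFinM lee_fin.
pose a := H / c.
have ge0 : 0 <= \int[mu]_(x in D) (f x ^+ 2 - (2 * a) * f x + a ^+ 2).
  apply: Rintegral_ge0 => x _.
  by have := sqr_ge0 (f x - a); rewrite sqrrB; nra.
have ia : mu.-integrable D (EFin \o (fun=> a ^+ 2)).
  exact: integrable_const.
have if1a : mu.-integrable D (EFin \o (fun x => 2 * a * f x)).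
  by have := integrableZl mD (2 * a) if1.
have idiff : mu.-integrable D (EFin \o (fun x => f x ^+ 2 - 2 * a * f x)).
  by have := integrableB mD if2 if1a.
move: ge0; rewrite RintegralD // RintegralB // RintegralZl // -/H -/S Rintegral_cst //.
have : fine (mu D) <= c.
  by rewrite -lee_fin fineK // ge0_fin_numE.
have : 0 <= fine (mu D) by rewrite fine_ge0.
set M := fine (mu D) => M0 Mc.
have aM : a ^+ 2 * M <= a ^+ 2 * c by rewrite ler_wpM2l ?sqr_ge0.
have -> : a ^+ 2 = H ^+ 2 / c ^+ 2 by rewrite /a expr_div_n.
rewrite -(ler_pM2l c0).
have -> : c * (S - 2 * a * H + H ^+ 2 / c ^+ 2 * M) =
   c * S - 2 * H ^+ 2 + H ^+ 2 * (M / c) by rewrite /a; field; exact: lt0r_neq0.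
have : M / c <= 1 by rewrite ler_pdivrMr // mul1r.
have := sqr_ge0 H; rewrite mulr0.
nra.
Qed.

End SquareIntegrable.

(** * Time reversal preserves Lebesgue measure *)

Section Reflection.
Variable R : realType.
Notation mu := (@lebesgue_measure R).

Lemma measurable_reflect (a : R) (D : set R) : measurable_fun D (fun x : R => a - x).
Proof. by apply: measurable_funB. Qed.

Lemma lebesgue_measure_reflect (a : R) (A : set (measurableTypeR R)) : measurable A ->
  mu A = pushforward mu ((fun x => a - x) : measurableTypeR R -> measurableTypeR R) A.
Proof.
have mphi : measurable_fun setT ((fun x => a - x) : measurableTypeR R -> measurableTypeR R).
  exact: measurable_reflect.
move=> mA; apply: lebesgue_measure_unique => //= _ [[x y]] _ <-.
rewrite /pushforward /=.
have -> : (fun z : R => a - z) @^-1` `]x, y] = `[a - y, a - x[%classic.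
  apply/seteqP; split=> z /=; rewrite !in_itv /=; lra.
rewrite !lebesgue_measure_itv /= !lte_fin ltrD2l ltrN2.
by case: ifP => // _; rewrite -!EFinB; congr (_%:E); ring.
Qed.

Lemma ge0_integral_reflect (a : R) (f : R -> \bar R) :
  measurable_fun `[0, a] f -> (forall x, x \in `[0, a] -> (0 <= f x)%E) ->
  (\int[mu]_(x in `[0%R, a]) f (a - x)%R = \int[mu]_(x in `[0%R, a]) f x)%E.
Proof.
move=> mf f0.
have preE : `[0, a]%classic = ((fun x => (a - x)%R) : measurableTypeR R -> measurableTypeR R) @^-1` `[0, a].
  by apply/seteqP; split=> z /=; rewrite !in_itv /=; lra.
rewrite {1}preE -ge0_integral_pushforward //=.
- apply: eq_measure_integral => [|mphi A mA _]; first exact: measurable_reflect.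
  exact/esym/lebesgue_measure_reflect.
- exact: measurable_reflect.
- by move=> x; rewrite inE; exact: f0.
Qed.

End Reflection.

(** * Joint measurability of processes *)

Section ProcessMeasurability.
Context d (T : measurableType d) (R : realType).
Variable tf : R.
Notation mu := (@lebesgue_measure R).
Notation TI := ([set: T] `*` `[0, tf]%classic : set (T * measurableTypeR R)).

Lemma measurable_TI : measurable TI.
Proof. by apply: measurableX => //; exact: measurable_itv. Qed.

Lemma measurable_process_mxop m p (M : 'M[R]_(p, m)) (X : T -> signal R m) :
  measurable_process tf X -> measurable_process tf (fun w => mxop M (X w)).
Proof.
move=> mX i.
have -> : (fun z : T * measurableTypeR R => mxop M (X z.1) z.2 i 0) =
    (fun z => \sum_j M i j * X z.1 z.2 j 0).
  by apply/funext => z; rewrite /mxop mxE.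
apply: measurable_sum => j; apply: measurable_funM; first exact: measurable_cst.
exact: mX.
Qed.

Lemma measurable_process_add m (X Y : T -> signal R m) :
  measurable_process tf X -> measurable_process tf Y ->
  measurable_process tf (fun w => X w \+ Y w).
Proof.
move=> mX mY i.
have -> : (fun z : T * measurableTypeR R => (X z.1 \+ Y z.1) z.2 i 0) =
    (fun z => X z.1 z.2 i 0 + Y z.1 z.2 i 0).
  by apply/funext => z; rewrite /= mxE.
by apply: measurable_funD; [exact: mX|exact: mY].
Qed.

Lemma measurable_process_scale m a (X : T -> signal R m) :
  measurable_process tf X ->
  measurable_process tf (fun w t => a *: X w t).
Proof.
move=> mX i.
have -> : (fun z : T * measurableTypeR R => (a *: X z.1 z.2) i 0) =
    (fun z => a * X z.1 z.2 i 0).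
  by apply/funext => z; rewrite /= mxE.
by apply: measurable_funM; [exact: measurable_cst|exact: mX].
Qed.

Lemma measurable_process_revop m (X : T -> signal R m) :
  measurable_process tf X ->
  measurable_process tf (fun w => revop tf (X w)).
Proof.
move=> mX i; pose h (z : T * measurableTypeR R) : T * measurableTypeR R :=
  (z.1, tf - z.2).
apply: (@measurable_comp _ _ _ _ _ _ TI _ _ h measurable_TI _ (mX i)).
  move=> _ [[w t] [_ /= tI] <-]; split=> //=.
  by move: tI; rewrite !in_itv /=; lra.
apply: measurable_funTS; apply: measurable_fun_pair => //.
by apply: measurable_funB.
Qed.

Lemma measurable_process_eq m (X Y : T -> signal R m) :
  (forall w t, t \in `[0, tf] -> X w t = Y w t) ->
  measurable_process tf X -> measurable_process tf Y.
Proof.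
move=> XY mX i; apply: eq_measurable_fun (mX i) => -[w t] /=.
by rewrite inE => -[_ /= tI]; rewrite XY.
Qed.

Lemma measurable_process_at m (X : T -> signal R m) t i :
  measurable_process tf X -> t \in `[0, tf] ->
  measurable_fun [set: T] (fun w => X w t i 0).
Proof.
move=> mX tI.
apply: (@measurable_comp _ _ _ _ _ _ TI _ _ (fun w => (w, t)) measurable_TI _ (mX i)).
  by move=> _ [w _ <-].
exact: pair2_measurable.
Qed.

Lemma measurable_process_path m (X : T -> signal R m) w i :
  measurable_process tf X -> measurable_fun `[0, tf] (fun t => X w t i 0).
Proof.
move=> mX.
apply: (@measurable_comp _ _ _ _ _ _ TI _ _ (fun t => (w, t)) measurable_TI _ (mX i)).
  by move=> _ [t tI <-].
apply: measurable_funTS; exact: pair1_measurable.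
Qed.

Lemma measurable_process_cst m (u : signal R m) :
  (forall i, measurable_fun `[0, tf] (fun t => u t i 0)) ->
  measurable_process tf (fun _ : T => u).
Proof.
move=> mu' i.
pose h (z : T * measurableTypeR R) : measurableTypeR R := z.2.
have hTI : h @` TI `<=` `[0, tf] by move=> _ [[w t] [_ tI] <-].
have mh : measurable_fun TI h by apply: measurable_funTS; exact: measurable_snd.
exact: measurable_comp hTI (mu' i) mh.
Qed.

(** Convolution with a matrix kernel k: the dynamic part of the input-output map
    of a linear system is the case of its impulse response. *)
Definition volterra m (k : R -> 'M[R]_m) (u : signal R m) : signal R m := fun t =>
  int_sig 0 t (fun tau => k (t - tau) *m u tau).

(** The truncated integrand g is jointly measurable on the whole product space.
    Tonelli for its positive and negative parts makes the integral measurable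
    even where a path is not integrable and the integral takes a default value,
    so the statement covers all outcomes and not only almost all. *)
Lemma measurable_process_volterra m (k : R -> 'M[R]_m) (X : T -> signal R m) :
  (forall i j, measurable_fun [set: R] (fun t => k t i j)) ->
  measurable_process tf X -> measurable_process tf (fun w => volterra k (X w)).
Proof.
move=> mk mX i.
pose Xt j := (fun z : T * measurableTypeR R => X z.1 z.2 j 0) \_ TI.
have mXt j : measurable_fun setT (Xt j).
  by apply/(measurable_restrictT _ measurable_TI); exact: mX.
pose pos := \1_(`[0, +oo[%classic) : measurableTypeR R -> R.
have mpos : measurable_fun setT pos.
  by apply: measurable_indic => //; exact: measurable_itv.
pose g (z : (T * measurableTypeR R) * measurableTypeR R) : R :=
  pos z.2 * pos (z.1.2 - z.2) *
  \sum_j k (z.1.2 - z.2) i j * Xt j (z.1.1, z.2).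
have mdiff : measurable_fun setT
    (fun z : (T * measurableTypeR R) * measurableTypeR R => z.1.2 - z.2 : R).
  apply: measurable_funB => //.
  exact: (measurableT_comp measurable_snd measurable_fst).
have mg : measurable_fun setT g.
  apply: measurable_funM; first apply: measurable_funM.
  - exact: (measurableT_comp mpos measurable_snd).
  - exact: (measurableT_comp mpos mdiff).
  - apply: measurable_sum => j; apply: measurable_funM.
      exact: (measurableT_comp (mk i j) mdiff).
    apply: (measurableT_comp (mXt j)); apply: measurable_fun_pair => //.
    exact: (measurableT_comp measurable_fst measurable_fst).
have mF : measurable_fun setT (fun z => \int[mu]_tau (g (z, tau))%:E)%E.
  have -> : (fun z => \int[mu]_tau (g (z, tau))%:E)%E =
     (fun z => fubini_F mu (EFin \o g)^\+ z - fubini_F mu (EFin \o g)^\- z)%E.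
    apply/funext => z; rewrite integralE /fubini_F.
    by congr (_ - _)%E; apply: eq_integral => x _; rewrite !(funeposE, funenegE).
  have mEg : measurable_fun setT (EFin \o g) by exact/measurable_EFinP.
  apply: emeasurable_funB; apply: measurable_fun_fubini_tonelli_F => //.
  - exact: measurable_funepos.
  - exact: measurable_funeneg.
have : measurable_fun TI (fun z => fine (\int[mu]_tau (g (z, tau))%:E)%E).
  apply: measurable_funTS.
  apply: measurableT_comp mF; exact: fine_measurable.
apply: eq_measurable_fun => -[w t]; rewrite inE => -[_ /= tI].
rewrite /volterra /int_sig mxE /Rintegral; congr fine.
rewrite [RHS]integral_mkcond; apply: eq_integral => tau _.
rewrite /g /pos /= !indicE !mem_setE !in_itv /= !andbT patchE mem_setE in_itv /=.
rewrite subr_ge0 -natrM mulnb; case: ifP => tauI; rewrite ?mul0r ?mul1r //.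
rewrite mxE; congr EFin; apply: eq_bigr => j _; congr (_ * _).
rewrite /Xt patchE mem_set //; split=> //=.
by move: tI tauI; rewrite !in_itv /=; lra.
Qed.

End ProcessMeasurability.

(** * Energy of a signal *)

Section Energy.
Variables (R : realType) (tf : R).
Hypothesis tf0 : 0 < tf.
Notation mu := (@lebesgue_measure R).

(** Squared L2 norm, as an extended real: infinite values occur for general
    measurable signals and sums of energies need no finiteness conditions. *)
Definition energy m (u : signal R m) : \bar R :=
  (\int[mu]_(t in `[0%R, tf]) (sqn (u t))%:E)%E.

Definition measurable_sig m (u : signal R m) : Prop :=
  forall i, measurable_fun `[0, tf] (fun t => u t i 0).

Lemma L2sigP m (u : signal R m) :
  L2sig tf u <-> measurable_sig u /\ (energy u < +oo)%E.
Proof.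
rewrite /L2sig /energy; under eq_integral do rewrite enorm_sqr.
by [].
Qed.

Lemma energy_ge0 m (u : signal R m) : (0 <= energy u)%E.
Proof. by apply: integral_ge0 => t _; rewrite lee_fin sqn_ge0. Qed.

Lemma energy_fin_num m (u : signal R m) : L2sig tf u -> energy u \is a fin_num.
Proof. by move=> /L2sigP[_ ?]; rewrite ge0_fin_numE ?energy_ge0. Qed.

Lemma L2norm_energy m (u : signal R m) : L2norm tf u = Num.sqrt (fine (energy u)).
Proof.
rewrite /L2norm /Rintegral /energy; congr (Num.sqrt (fine _)).
by apply: eq_integral => t _; rewrite enorm_sqr.
Qed.

Lemma measurable_sqn m (u : signal R m) : measurable_sig u ->
  measurable_fun `[0, tf] (fun t => (sqn (u t))%:E).
Proof.
move=> mu'; apply/measurable_EFinP; apply: measurable_sum => i.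
exact: measurable_funX.
Qed.

Lemma energy_le m p (u : signal R m) (v : signal R p) c : 0 <= c ->
  measurable_sig u -> measurable_sig v ->
  (forall t, t \in `[0, tf] -> sqn (u t) <= c * sqn (v t)) ->
  (energy u <= c%:E * energy v)%E.
Proof.
move=> c0 mu' mv uv; rewrite /energy -ge0_integralZl //.
- apply: ge0_le_integral => //.
  + by move=> t _; rewrite lee_fin sqn_ge0.
  + exact: measurable_sqn.
  + by apply: measurable_funeM; exact: measurable_sqn.
- exact: measurable_sqn.
- by move=> t _; rewrite lee_fin sqn_ge0.
Qed.

Lemma energyD_le m d (u v : signal R m) : 0 < d ->
  measurable_sig u -> measurable_sig v ->
  (energy (u \+ v)%R <= (1 + d)%:E * energy u + (1 + d^-1)%:E * energy v)%E.
Proof.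
move=> d0 mu' mv; have d10 : 0 <= d^-1 by rewrite invr_ge0 ltW.
have mZ c w : measurable_sig (w : signal R m) ->
    measurable_fun `[0, tf] (fun t => c%:E * (sqn (w t))%:E)%E.
  by move=> mw; apply: measurable_funeM; exact: measurable_sqn.
rewrite /energy -!ge0_integralZl //; try (exact: measurable_sqn);
  try (by move=> t _; rewrite lee_fin sqn_ge0); try (by rewrite lee_fin; lra).
rewrite -ge0_integralD //; try (exact: mZ);
  try (by move=> t _; rewrite -EFinM lee_fin mulr_ge0 ?sqn_ge0 //; lra).
apply: ge0_le_integral => //.
+ by move=> t _; rewrite lee_fin sqn_ge0.
+ apply: measurable_sqn => i.
  have -> : (fun t => (u \+ v) t i 0) = (fun t => u t i 0 + v t i 0).
    by apply/funext => t; rewrite /= mxE.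
  exact: measurable_funD.
+ by apply: emeasurable_funD; exact: mZ.
+ by move=> t _; rewrite -!EFinM -EFinD lee_fin sqnD_le.
Qed.

Lemma measurable_sig_eq m (u v : signal R m) :
  (forall t, t \in `[0, tf] -> u t = v t) -> measurable_sig u -> measurable_sig v.
Proof.
move=> uv mu' i; apply: eq_measurable_fun (mu' i) => t; rewrite inE => tI.
by rewrite uv.
Qed.

Lemma energy_eq m (u v : signal R m) :
  (forall t, t \in `[0, tf] -> u t = v t) -> energy u = energy v.
Proof. by move=> uv; apply: eq_integral => t; rewrite inE => tI; rewrite uv. Qed.

Lemma L2sig_eq m (u v : signal R m) :
  (forall t, t \in `[0, tf] -> u t = v t) -> L2sig tf u -> L2sig tf v.
Proof.
move=> uv /L2sigP[mu' nu]; apply/L2sigP; split; first exact: measurable_sig_eq uv _.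
by rewrite -(energy_eq uv).
Qed.

(** A signal is a process on a one-point space, so measurability of paths is
    inherited from joint measurability. *)
Lemma measurable_sig_process m (F : signal R m -> signal R m) :
  (forall X : unit -> signal R m, measurable_process tf X ->
     measurable_process tf (fun w => F (X w))) ->
  forall u, measurable_sig u -> measurable_sig (F u).
Proof.
move=> HF u mu' i; have := HF (fun=> u) (@measurable_process_cst _ unit R tf m u mu').
exact: (@measurable_process_path _ unit R tf m (fun=> F u) tt i).
Qed.

Lemma measurable_sig_mxop m p (M : 'M[R]_(p, m)) u :
  measurable_sig u -> measurable_sig (mxop M u).
Proof.
move=> mu' i.
have -> : (fun t => mxop M u t i 0) = (fun t => \sum_j M i j * u t j 0).
  by apply/funext => t; rewrite mxE.
by apply: measurable_sum => j; apply: measurable_funM.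
Qed.

Lemma measurable_sigD m (u v : signal R m) :
  measurable_sig u -> measurable_sig v -> measurable_sig (u \+ v).
Proof.
move=> mu' mv i; have -> : (fun t => (u \+ v) t i 0) = (fun t => u t i 0 + v t i 0).
  by apply/funext => t; rewrite /= mxE.
exact: measurable_funD.
Qed.

Lemma measurable_sigZ m a (u : signal R m) :
  measurable_sig u -> measurable_sig (fun t => a *: u t).
Proof.
move=> mu' i; have -> : (fun t => (a *: u t) i 0) = (fun t => a * u t i 0).
  by apply/funext => t; rewrite /= mxE.
exact: measurable_funM.
Qed.

Lemma measurable_sig_revop m (u : signal R m) :
  measurable_sig u -> measurable_sig (revop tf u).
Proof.
apply: (@measurable_sig_process _ (@revop R tf m)) => X.
exact: measurable_process_revop.
Qed.

Lemma energy_mxop m p (M : 'M[R]_(p, m)) u : measurable_sig u ->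
  (energy (mxop M u) <= (sqfrob M)%:E * energy u)%E.
Proof.
move=> mu'; apply: energy_le => //; first exact: sqfrob_ge0.
- exact: measurable_sig_mxop.
- by move=> t _; exact: sqn_mulmx.
Qed.

Lemma energyZ m a (u : signal R m) : measurable_sig u ->
  (energy (fun t => a *: u t)%R = (a ^+ 2)%:E * energy u)%E.
Proof.
move=> mu'; rewrite /energy -ge0_integralZl //.
- by apply: eq_integral => t _; rewrite sqnZ.
- exact: measurable_sqn.
- by move=> t _; rewrite lee_fin sqn_ge0.
- by rewrite lee_fin sqr_ge0.
Qed.

Lemma energy_revop m (u : signal R m) : measurable_sig u ->
  energy (revop tf u) = energy u.
Proof.
move=> mu'; rewrite /energy /revop.
apply: (@ge0_integral_reflect _ _ (fun t => (sqn (u t))%:E)).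
  exact: measurable_sqn.
by move=> t _; rewrite lee_fin sqn_ge0.
Qed.

Lemma L2sig_mxop m p (M : 'M[R]_(p, m)) u : L2sig tf u -> L2sig tf (mxop M u).
Proof.
move=> Hu; have [mu' nu] := (L2sigP u).1 Hu.
apply/L2sigP; split; first exact: measurable_sig_mxop.
apply: le_lt_trans (energy_mxop M mu') _.
by rewrite lte_mul_pinfty ?lee_fin ?sqfrob_ge0.
Qed.

Lemma L2sigD m (u v : signal R m) :
  L2sig tf u -> L2sig tf v -> L2sig tf (u \+ v).
Proof.
move=> /L2sigP[mu' nu] /L2sigP[mv nv]; apply/L2sigP; split.
  exact: measurable_sigD.
apply: le_lt_trans (energyD_le ltr01 mu' mv) _.
by rewrite lte_add_pinfty // lte_mul_pinfty // lee_fin; lra.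
Qed.

Lemma L2sigZ m a (u : signal R m) : L2sig tf u -> L2sig tf (fun t => a *: u t).
Proof.
move=> /L2sigP[mu' nu]; apply/L2sigP; split; first exact: measurable_sigZ.
by rewrite energyZ // lte_mul_pinfty // lee_fin sqr_ge0.
Qed.

Lemma L2sig_revop m (u : signal R m) : L2sig tf u -> L2sig tf (revop tf u).
Proof.
move=> /L2sigP[mu' nu]; apply/L2sigP; split; first exact: measurable_sig_revop.
by rewrite energy_revop.
Qed.

Lemma mu_itv0 t : 0 <= t -> mu `[0, t]%classic = t%:E.
Proof.
move=> t0; rewrite lebesgue_measure_itv /= lte_fin; case: ifP => [_|].
  by rewrite -EFinB subr0.
by move=> /negbT; rewrite -leNgt => t0'; congr (_%:E); apply: le_anti; rewrite t0 t0'.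
Qed.

Lemma energy_cst_le m (u : signal R m) c : measurable_sig u ->
  (forall t, t \in `[0, tf] -> sqn (u t) <= c) -> (energy u <= (tf * c)%:E)%E.
Proof.
move=> mu' uc.
have -> : (tf * c)%:E = (\int[mu]_(t in `[0%R, tf]) cst c%:E t)%E.
  by rewrite integral_cst //= mu_itv0 ?ltW // EFinM muleC.
apply: ge0_le_integral => //.
- by move=> t _; rewrite lee_fin sqn_ge0.
- exact: measurable_sqn.
Qed.

Lemma L2sig_bounded m (u : signal R m) c : measurable_sig u ->
  (forall t, t \in `[0, tf] -> sqn (u t) <= c) -> L2sig tf u.
Proof.
move=> mu' uc; apply/L2sigP; split=> //.
by apply: le_lt_trans (energy_cst_le mu' uc) _; rewrite ltry.
Qed.

Lemma L2sig_entry m (u : signal R m) i : L2sig tf u ->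
  sq_integrable mu `[0, tf] (fun t => u t i 0).
Proof.
move=> /L2sigP[mu' nu]; split; first exact: mu'.
apply: le_lt_trans nu; apply: ge0_le_integral => //.
- by move=> t _; rewrite lee_fin sqr_ge0.
- by apply/measurable_EFinP; apply: measurable_funX; exact: mu'.
- exact: measurable_sqn.
- by move=> t _; rewrite lee_fin sqr_le_sqn.
Qed.

End Energy.

(** * Integrals of scalar products *)

Section IntegralTools.
Variable R : realType.

Lemma dotv_le m (u v : 'cV[R]_m) : `|dotv u v| <= sqn u + sqn v.
Proof.
have H e : e = 1 \/ e = -1 -> e * dotv u v <= sqn u + sqn v.
  move=> he; have := sqn_ge0 (u - e *: v); have := sqn_ge0 u; have := sqn_ge0 v.
  have dz : dotv u (- e *: v) = - e * dotv u v.
    by rewrite -{1}[u]scale1r dotvZ mul1r.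
  rewrite sqnD -scaleNr sqnZ dz sqrrN.
  have -> : e ^+ 2 = 1 by case: he => ->; rewrite ?sqrrN expr1n.
  by nra.
by rewrite ler_norml; apply/andP; split; [have := H (-1) (or_intror erefl)|
  have := H 1 (or_introl erefl)]; lra.
Qed.

Lemma dotv_int d (T : measurableType d) (mu : {measure set T -> \bar R})
    (D : set T) m (a : 'cV[R]_m) (f : T -> 'cV[R]_m) : measurable D ->
  (forall i, mu.-integrable D (EFin \o (fun x => f x i 0))) ->
  (\int[mu]_(x in D) (dotv a (f x))%:E =
   (dotv a (\col_i \int[mu]_(x in D) f x i 0)%R)%:E)%E.
Proof.
move=> mD intf; rewrite /dotv -sumEFin; under eq_integral do rewrite -sumEFin.
rewrite integral_sum //; last first.
  by move=> i; have := integrableZl mD (a i 0) (intf i).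
apply: eq_bigr => i _; rewrite mxE /Rintegral.
have /integrable_fin_num intfin := intf i.
rewrite EFinM fineK ?intfin // -integralZl //; exact: intf.
Qed.

Lemma integral_support d (T : measurableType d) (mu : {measure set T -> \bar R})
    (D E : set T) (f g : T -> \bar R) :
  (forall x, D x -> E x -> f x = g x) ->
  (forall x, D x -> ~ E x -> f x = 0%E) ->
  (forall x, E x -> ~ D x -> g x = 0%E) ->
  (\int[mu]_(x in D) f x = \int[mu]_(x in E) g x)%E.
Proof.
move=> fg f0 g0; rewrite integral_mkcond [RHS]integral_mkcond.
apply: eq_integral => x _; rewrite !patchE.
case: ifPn => [|]; rewrite ?inE ?notin_setE => Dx; case: ifPn => [|];
  rewrite ?inE ?notin_setE => Ex //.
- exact: fg.
- exact: f0.
- by rewrite g0.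
Qed.

Lemma integral_reflect (a : R) (f : R -> R) : measurable_fun `[0, a] f ->
  (\int[lebesgue_measure]_(x in `[0%R, a]) (f (a - x)%R)%:E =
   \int[lebesgue_measure]_(x in `[0%R, a]) (f x)%:E)%E.
Proof.
move=> mf; rewrite integralE [RHS]integralE.
have mEf : measurable_fun `[0, a] (EFin \o f) by exact/measurable_EFinP.
have <- := @ge0_integral_reflect R a ((EFin \o f)^\+)%E; last 2 first.
- exact: measurable_funepos.
- by move=> x _; exact: funepos_ge0.
have <- := @ge0_integral_reflect R a ((EFin \o f)^\-)%E; last 2 first.
- exact: measurable_funeneg.
- by move=> x _; exact: funeneg_ge0.
by congr (_ - _)%E; apply: eq_integral => x _; rewrite !(funeposE, funenegE).
Qed.

End IntegralTools.

(** * Convolution operators *)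

Section Volterra.
Variables (R : realType) (tf : R) (m : nat) (k : R -> 'M[R]_m) (kap : R).
Hypothesis tf0 : 0 < tf.
Hypothesis mk : forall i j, measurable_fun [set: R] (fun t => k t i j).
Hypothesis kb : forall t, t \in `[0, tf] -> sqfrob (k t) <= kap.
Notation mu := (@lebesgue_measure R).

Lemma kap_ge0 : 0 <= kap.
Proof.
apply: le_trans (sqfrob_ge0 (k 0)) (kb _).
by rewrite in_itv /= lexx ltW.
Qed.

Lemma measurable_kernel_row (u : signal R m) t i : t \in `[0, tf] ->
  measurable_sig tf u ->
  measurable_fun `[0, t] (fun tau => (k (t - tau) *m u tau) i 0).
Proof.
move=> tI mu'.
have -> : (fun tau => (k (t - tau) *m u tau) i 0) =
    (fun tau => \sum_j k (t - tau) i j * u tau j 0).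
  by apply/funext => tau; rewrite mxE.
apply: measurable_sum => j; apply: measurable_funM.
  apply: measurable_funTS; apply: measurableT_comp (mk i j) _.
  exact: measurable_reflect.
apply: measurable_funS (mu' j) => // x /=; move: tI; rewrite !in_itv /=; lra.
Qed.

Lemma kernel_row_energy (u : signal R m) t : t \in `[0, tf] ->
  measurable_sig tf u ->
  (\int[mu]_(tau in `[0%R, t]) (sqn (k (t - tau)%R *m u tau))%:E <=
    kap%:E * energy tf u)%E.
Proof.
move=> tI mu'; rewrite /energy -ge0_integralZl //; last first.
- by rewrite lee_fin kap_ge0.
- by move=> x _; rewrite lee_fin sqn_ge0.
- exact: measurable_sqn.
have sub : `[0, t]%classic `<=` `[0, tf]%classic.
  by move=> x /=; move: tI; rewrite !in_itv /=; lra.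
have mr : measurable_fun `[0, tf] (fun x => kap%:E * (sqn (u x))%:E)%E.
  by apply: measurable_funeM; exact: measurable_sqn.
apply: (@le_trans _ _ (\int[mu]_(x in `[0%R, t]) (kap%:E * (sqn (u x))%:E))%E).
  apply: ge0_le_integral => //.
  - by move=> x _; rewrite lee_fin sqn_ge0.
  - apply/measurable_EFinP; apply: measurable_sum => i; apply: measurable_funX.
    exact: measurable_kernel_row.
  - exact: measurable_funS mr.
  - move=> x /= xt; rewrite -EFinM lee_fin.
    apply: le_trans (sqn_mulmx _ _) _; rewrite ler_wpM2r ?sqn_ge0 // kb //.
    by move: tI xt; rewrite !in_itv /=; lra.
apply: ge0_subset_integral => //.
by move=> x _; rewrite -EFinM lee_fin mulr_ge0 ?sqn_ge0 // kap_ge0.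
Qed.

Lemma kernel_row_sq_integrable (u : signal R m) t i : t \in `[0, tf] ->
  L2sig tf u ->
  sq_integrable mu `[0, t] (fun tau => (k (t - tau) *m u tau) i 0).
Proof.
move=> tI /L2sigP[mu' nu]; split; first exact: measurable_kernel_row.
have : (kap%:E * energy tf u < +oo)%E by rewrite lte_mul_pinfty // lee_fin kap_ge0.
apply: le_lt_trans; apply: le_trans (kernel_row_energy tI mu').
apply: ge0_le_integral => //.
- by move=> x _; rewrite lee_fin sqr_ge0.
- by apply/measurable_EFinP; apply: measurable_funX; exact: measurable_kernel_row.
- apply/measurable_EFinP; apply: measurable_sum => j; apply: measurable_funX.
  exact: measurable_kernel_row.
- by move=> x _; rewrite lee_fin sqr_le_sqn.
Qed.

Lemma kernel_row_integrable (u : signal R m) t i : t \in `[0, tf] ->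
  L2sig tf u ->
  mu.-integrable `[0, t] (EFin \o (fun tau => (k (t - tau) *m u tau) i 0)).
Proof.
move=> tI Hu; apply: sq_integrable_integrable => //.
  by have := tI; rewrite in_itv /= => /andP[t0 _]; rewrite mu_itv0 // ltry.
exact: kernel_row_sq_integrable.
Qed.

(** The value at every single instant is controlled by the energy of the input;
    this is what lets energy estimates yield estimates at fixed times. *)
Lemma sqn_volterra_le (u : signal R m) t : t \in `[0, tf] -> L2sig tf u ->
  ((sqn (volterra k u t))%:E <= (tf * kap)%:E * energy tf u)%E.
Proof.
move=> tI Hu; have [mu' nu] := (L2sigP _ u).1 Hu.
have tt : (mu `[0%R, t]%classic <= tf%:E)%E.
  have := tI; rewrite in_itv /= => /andP[t0 t1].
  by rewrite mu_itv0 // lee_fin.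
rewrite EFinM -muleA.
apply: (@le_trans _ _ (tf%:E * \int[mu]_(tau in `[0%R, t])
    (sqn (k (t - tau)%R *m u tau))%:E)%E); last first.
  by rewrite lee_pmul2l //; exact: kernel_row_energy.
rewrite /sqn -sumEFin; under eq_integral do rewrite -sumEFin.
rewrite ge0_integral_sum //; last 2 first.
- move=> i; apply/measurable_EFinP; apply: measurable_funX.
  exact: measurable_kernel_row.
- by move=> i x _; rewrite lee_fin sqr_ge0.
rewrite ge0_sume_distrr; last first.
  by move=> i _; apply: integral_ge0 => x _; rewrite lee_fin sqr_ge0.
apply: lee_sum => i _; rewrite /volterra /int_sig mxE.
apply: sqr_Rintegral_le => //.
exact: kernel_row_sq_integrable.
Qed.

Lemma measurable_sig_volterra (u : signal R m) :
  measurable_sig tf u -> measurable_sig tf (volterra k u).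
Proof.
apply: measurable_sig_process => X; exact: measurable_process_volterra.
Qed.

Lemma energy_volterra_le (u : signal R m) : L2sig tf u ->
  (energy tf (volterra k u) <= (tf ^+ 2 * kap)%:E * energy tf u)%E.
Proof.
move=> Hu; have [mu' nu] := (L2sigP _ u).1 Hu.
have nf := energy_fin_num Hu.
rewrite -(fineK nf) expr2 -mulrA -EFinM -mulrA.
apply: energy_cst_le => //; first exact: measurable_sig_volterra.
move=> t tI; rewrite -lee_fin EFinM fineK //.
exact: sqn_volterra_le.
Qed.

Lemma L2sig_volterra (u : signal R m) : L2sig tf u -> L2sig tf (volterra k u).
Proof.
move=> Hu; have [mu' nu] := (L2sigP _ u).1 Hu.
apply/L2sigP; split; first exact: measurable_sig_volterra.
apply: le_lt_trans (energy_volterra_le Hu) _.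
by rewrite lte_mul_pinfty // lee_fin mulr_ge0 ?sqr_ge0 ?kap_ge0.
Qed.

Lemma volterra_eq (u v : signal R m) : (forall t, t \in `[0, tf] -> u t = v t) ->
  forall t, t \in `[0, tf] -> volterra k u t = volterra k v t.
Proof.
move=> uv t tI; rewrite /volterra /int_sig; apply/matrixP => i j; rewrite !mxE.
apply: eq_Rintegral => x; rewrite inE /= => xI; rewrite uv //.
by move: tI xI; rewrite !in_itv /=; lra.
Qed.

Lemma volterraD (u v : signal R m) t : t \in `[0, tf] -> L2sig tf u -> L2sig tf v ->
  volterra k (u \+ v) t = volterra k u t + volterra k v t.
Proof.
move=> tI Hu Hv; apply/matrixP => i j; rewrite !mxE.
rewrite -RintegralD //; try exact: kernel_row_integrable.
by apply: eq_Rintegral => x _; rewrite /= mulmxDr mxE.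
Qed.

Lemma volterraZ a (u : signal R m) t : t \in `[0, tf] -> L2sig tf u ->
  volterra k (fun t => a *: u t) t = a *: volterra k u t.
Proof.
move=> tI Hu; apply/matrixP => i j; rewrite !mxE.
rewrite -RintegralZl //; last exact: kernel_row_integrable.
by apply: eq_Rintegral => x _; rewrite -scalemxAr mxE.
Qed.

End Volterra.

(** * Time reversal gives the adjoint of a convolution *)

Section Adjoint.
Variables (R : realType) (tf : R) (m : nat) (k : R -> 'M[R]_m) (kap : R).
Hypothesis tf0 : 0 < tf.
Hypothesis mk : forall i j, measurable_fun [set: R] (fun t => k t i j).
Hypothesis kb : forall t, t \in `[0, tf] -> sqfrob (k t) <= kap.
Notation mu := (@lebesgue_measure R).
Variables (Sig : 'M[R]_m) (v z : signal R m).
Hypothesis Sigk : forall t, t \in `[0, tf] -> Sig *m k t = (k t)^T *m Sig.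
Hypothesis Hv : L2sig tf v.
Hypothesis Hz : L2sig tf z.

Let RR := (measurableTypeR R * measurableTypeR R)%type.
Let pos : measurableTypeR R -> R := \1_(`[0, +oo[%classic).
Let vt i : measurableTypeR R -> R := (fun t => v t i 0) \_ `[0, tf]%classic.
Let zt i : measurableTypeR R -> R := (fun t => z t i 0) \_ `[0, tf]%classic.
(** Integrand of the double integral over the triangle t <= r to which both
    scalar products reduce; v and z are extended by zero. *)
Let Phi (p : RR) : R := pos (p.2 - p.1) *
  \sum_i vt i p.1 * \sum_j (Sig *m k (p.2 - p.1)) i j * zt j p.2.

Let measurable_patch (u : signal R m) i : L2sig tf u ->
  measurable_fun [set: measurableTypeR R] ((fun t => u t i 0) \_ `[0, tf]%classic).
Proof.
move=> /L2sigP[mu' _].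
by apply/(measurable_restrictT _ (measurable_itv _)); exact: mu'.
Qed.

Let mPhi : measurable_fun setT Phi.
Proof.
have mdiff : measurable_fun setT (fun p : RR => p.2 - p.1 : R).
  by apply: measurable_funB.
have mpos : measurable_fun setT pos.
  by apply: measurable_indic => //; exact: measurable_itv.
apply: measurable_funM; first exact: (measurableT_comp mpos mdiff).
apply: measurable_sum => i; apply: measurable_funM.
  exact: (measurableT_comp (measurable_patch i Hv) measurable_fst).
apply: measurable_sum => j; apply: measurable_funM; last first.
  exact: (measurableT_comp (measurable_patch j Hz) measurable_snd).
have -> : (fun p : RR => (Sig *m k (p.2 - p.1)) i j) =
    (fun p => \sum_l Sig i l * k (p.2 - p.1) l j).
  by apply/funext => p; rewrite mxE.
apply: measurable_sum => l; apply: measurable_funM; first exact: measurable_cst.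
exact: (measurableT_comp (mk l j) mdiff).
Qed.

Let PhiE t r : t \in `[0, tf] -> r \in `[0, tf] ->
  Phi (t, r) = pos (r - t) * dotv (v t) (Sig *m (k (r - t) *m z r)).
Proof.
move=> tI rI; congr (_ * _); rewrite /dotv; apply: eq_bigr => i _ /=.
rewrite /vt patchE mem_set //; congr (_ * _); rewrite mulmxA [RHS]mxE.
by apply: eq_bigr => j _; rewrite /zt patchE mem_set.
Qed.

Let Phi0l t r : ~ (t \in `[0, tf]) -> Phi (t, r) = 0.
Proof.
move=> tI; rewrite /Phi big1 ?mulr0 // => i _.
by rewrite /vt patchE memNset ?mul0r.
Qed.

Let Phi0r t r : ~ (r \in `[0, tf]) -> Phi (t, r) = 0.
Proof.
move=> rI; rewrite /Phi big1 ?mulr0 // => i _.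
rewrite big1 ?mulr0 // => j _.
by rewrite /zt patchE memNset ?mulr0.
Qed.

Let posE (x : R) : pos x = (0 <= x)%R%:R.
Proof. by rewrite /pos indicE mem_setE in_itv /= andbT. Qed.

(** |Phi(t, r)| is at most |v(t)|^2 + c |z(r)|^2, which is integrable because the
    square [0, tf]^2 has finite measure. *)
Let iPhi : (mu \x mu)%E.-integrable setT (EFin \o Phi).
Proof.
have [mv nv] := (L2sigP _ v).1 Hv; have [mz nz] := (L2sigP _ z).1 Hz.
have mEPhi : measurable_fun setT (EFin \o Phi) by exact/measurable_EFinP.
apply/integrable12ltyP => //.
have c0 : 0 <= sqfrob Sig * kap by rewrite mulr_ge0 ?sqfrob_ge0 ?(kap_ge0 tf0 kb).
set c := sqfrob Sig * kap in c0.
have inner t : (\int[mu]_r `|(EFin \o Phi) (t, r)| <=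
    (((fun t => (tf * sqn (v t) + c * fine (energy tf z))%:E) \_ `[0%R, tf]%classic) t))%E.
  rewrite patchE; case: ifPn => [|tI]; last first.
    rewrite integral0_eq // => r _ /=; rewrite Phi0l ?normr0 //.
    by move=> tI'; move: tI; rewrite mem_set.
  rewrite inE /= => tI.
  rewrite (@integral_support _ _ _ mu setT `[0, tf]%classic _
    (fun r => `|(EFin \o Phi) (t, r)|%E)) //;
    try (by move=> r _ rI /=; rewrite Phi0r // normr0); try (by move=> r _ []).
  have -> : (tf * sqn (v t) + c * fine (energy tf z))%:E =
     (\int[mu]_(r in `[0%R, tf]) ((sqn (v t))%:E + c%:E * (sqn (z r))%:E))%E.
    rewrite ge0_integralD //;
      try (by move=> x _; rewrite lee_fin sqn_ge0);
      try (by move=> x _; rewrite -EFinM lee_fin; apply: mulr_ge0 => //; exact: sqn_ge0);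
      try (by apply: measurable_funeM; exact: measurable_sqn).
    rewrite integral_cst //= mu_itv0 ?ltW // ge0_integralZl //;
      try (by move=> x _; rewrite lee_fin sqn_ge0);
      try exact: measurable_sqn.
    by rewrite EFinD EFinM muleC EFinM fineK // energy_fin_num.
  apply: ge0_le_integral => //.
  - apply: measurableT_comp => //; apply: measurable_funTS.
    by apply: (measurableT_comp mEPhi); exact: pair1_measurable.
  - apply: emeasurable_funD => //; apply: measurable_funeM; exact: measurable_sqn.
  - move=> r rI; rewrite /= -EFinM -EFinD lee_fin PhiE // posE.
    case: (lerP 0 (r - t)) => rt; last first.
      rewrite mul0r normr0; apply: addr_ge0; first exact: sqn_ge0.
      by apply: mulr_ge0 => //; exact: sqn_ge0.
    rewrite mul1r; apply: le_trans (dotv_le _ _) _; rewrite lerD2l.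
    apply: le_trans (sqn_mulmx _ _) _; rewrite -mulrA ler_wpM2l ?sqfrob_ge0 //.
    apply: le_trans (sqn_mulmx _ _) _; rewrite ler_wpM2r ?sqn_ge0 // kb //.
    by move: tI rI rt; rewrite /= !in_itv /=; lra.
apply: (@le_lt_trans _ _ (\int[mu]_t
  ((fun t => (tf * sqn (v t) + c * fine (energy tf z))%:E) \_ `[0%R, tf]%classic) t)%E).
  apply: ge0_le_integral => //.
  - by move=> t _; apply: integral_ge0.
  - have := @measurable_fun_fubini_tonelli_F _ _ _ _ R mu (fun p => `|(EFin \o Phi) p|%E).
    by apply => //; exact: measurableT_comp.
  - apply/(measurable_restrictT _ (measurable_itv _)); apply/measurable_EFinP.
    apply: measurable_funD => //; apply: measurable_funM => //.
    by apply/measurable_EFinP; exact: measurable_sqn.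
rewrite -integral_mkcond.
under eq_integral do rewrite EFinD EFinM.
rewrite ge0_integralD //;
  try (by move=> x _; rewrite -EFinM lee_fin; apply: mulr_ge0; [exact: ltW|exact: sqn_ge0]);
  try (by move=> x _; rewrite lee_fin; apply: mulr_ge0 => //; exact/fine_ge0/energy_ge0);
  try (by apply: measurable_funeM; exact: measurable_sqn).
rewrite ge0_integralZl //; try exact: measurable_sqn;
  try (by move=> x _; rewrite lee_fin sqn_ge0); try (by rewrite lee_fin ltW).
rewrite integral_cst //= mu_itv0 ?ltW // lte_add_pinfty ?ltry //.
by rewrite lte_mul_pinfty // lee_fin ltW.
Qed.

(** Only here does the symmetry of the kernel enter: it moves Sig k from z
    to v. *)
Let inner_right r : r \in `[0, tf] ->
  (\int[mu]_t (Phi (t, r))%:E = (dotv (volterra k v r) (Sig *m z r))%:E)%E.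
Proof.
move=> rI.
rewrite (@integral_support _ _ _ mu setT `[0, r]%classic _
    (fun t => (dotv (Sig *m z r) (k (r - t) *m v t))%:E)) //.
- rewrite dotv_int //; last by move=> i; exact: (kernel_row_integrable tf0 mk kb).
  by congr EFin; rewrite /dotv; apply: eq_bigr => i _; rewrite mulrC.
- move=> t _ tr; have tI : t \in `[0, tf].
    by move: rI tr; rewrite /= !in_itv /=; lra.
  rewrite PhiE // posE subr_ge0.
  have -> : t <= r by move: tr; rewrite /= in_itv /= => /andP[].
  rewrite mul1r mulmxA Sigk; last by move: rI tr; rewrite /= !in_itv /=; lra.
  rewrite -mulmxA -dotv_mulmxl; congr EFin; rewrite /dotv.
  by apply: eq_bigr => i _; rewrite mulrC.
- move=> t _ tr; have [tI|tI] := boolP (t \in `[0, tf]); last first.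
    by rewrite Phi0l //; exact/negP.
  rewrite PhiE // posE; case: (lerP 0 (r - t)) => rt; last by rewrite mul0r.
  by exfalso; apply: tr; move: tI rt; rewrite /= !in_itv /=; lra.
- by move=> t _ [].
Qed.

Let inner_left t : t \in `[0, tf] ->
  (\int[mu]_r (Phi (t, r))%:E =
   (dotv (v t) (Sig *m volterra k (revop tf z) (tf - t)))%:E)%E.
Proof.
move=> tI.
rewrite (@integral_support _ _ _ mu setT `[0, tf]%classic _
    (fun r => (Phi (t, r))%:E)) //;
  try (by move=> r _ rI; rewrite Phi0r); try (by move=> r _ []).
rewrite -(@integral_reflect R tf (fun r => Phi (t, r))); last first.
  apply: measurable_funTS; apply: (measurableT_comp mPhi).
  exact: pair1_measurable.
have ttI : tf - t \in `[0, tf] by move: tI; rewrite !in_itv /=; lra.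
rewrite (@integral_support _ _ _ mu `[0, tf]%classic `[0, tf - t]%classic _
    (fun s => (dotv (Sig^T *m v t) (k (tf - t - s) *m revop tf z s))%:E)).
- rewrite dotv_int //; first by rewrite dotv_mulmxl trmxK.
  by move=> i; apply: (kernel_row_integrable tf0 mk kb) => //; exact: L2sig_revop.
- move=> s sI st; have sI' : tf - s \in `[0, tf].
    by move: sI; rewrite /= !in_itv /=; lra.
  rewrite PhiE // posE.
  have -> : 0 <= tf - s - t by move: st; rewrite /= in_itv /=; lra.
  by rewrite mul1r dotv_mulmxl trmxK -addrA (addrC (- s)) addrA.
- move=> s sI st; have sI' : tf - s \in `[0, tf].
    by move: sI; rewrite /= !in_itv /=; lra.
  rewrite PhiE // posE; case: (lerP 0 (tf - s - t)) => rt; last by rewrite mul0r.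
  by exfalso; apply: st; move: sI rt; rewrite /= !in_itv /=; lra.
- move=> s st sI; exfalso; apply: sI; move: st ttI.
  by rewrite /= !in_itv /=; lra.
Qed.

(** Both sides are the double integral of v(t)' Sig k(r - t) z(r) over t <= r,
    in the two orders of integration; on the left, the two time reversals turn
    the integral over the past of tf - t into one over the future of t. *)
Lemma volterra_adjoint :
  (\int[mu]_(t in `[0%R, tf]) (dotv (v t) (Sig *m volterra k (revop tf z) (tf - t)%R))%:E =
   \int[mu]_(t in `[0%R, tf]) (dotv (volterra k v t) (Sig *m z t))%:E)%E.
Proof.
have left : (\int[mu]_(t in `[0%R, tf])
    (dotv (v t) (Sig *m volterra k (revop tf z) (tf - t)%R))%:E =
  \int[mu]_t \int[mu]_r (Phi (t, r))%:E)%E.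
  apply: integral_support => [t tI _|t _ []//|t _ tI]; first by rewrite inner_left.
  by rewrite integral0_eq // => r _; rewrite Phi0l.
apply: (etrans left); apply: (etrans (Fubini iPhi)).
apply: integral_support => [r _ rI|r _ rI|r _ []//]; first exact: inner_right.
by rewrite integral0_eq // => t _; rewrite /= Phi0r.
Qed.

End Adjoint.

(** * Zero-mean processes with bounded second moments *)

Section SecondOrder.
Context d (T : measurableType d) (R : realType) (P : probability T R).
Variables (tf : R) (m : nat).
Hypothesis tf0 : 0 < tf.
Notation mu := (@lebesgue_measure R).
Notation TI := ([set: T] `*` `[0, tf]%classic : set (T * measurableTypeR R)).

(** The class of processes that contains the noises and is preserved by all
    operators of the iteration.  Paths are required to be square-integrable for
    every outcome, since the operators are linear only on such signals. *)
Definition second_order (c : R) (X : T -> signal R m) : Prop :=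
  [/\ measurable_process tf X,
      forall w, L2sig tf (X w),
      forall t, t \in `[0, tf] -> (\int[P]_w (sqn (X w t))%:E <= c%:E)%E
    & zero_mean P tf X].

Lemma expectationE (X : T -> R) : ('E_P[X] = \int[P]_w (X w)%:E)%E.
Proof. by rewrite unlock. Qed.

Section MeasurableEnergy.
Variables (X : T -> signal R m).
Hypothesis mX : measurable_process tf X.

Lemma measurable_sqn_at t : t \in `[0, tf] ->
  measurable_fun [set: T] (fun w => (sqn (X w t))%:E).
Proof.
move=> tI; apply/measurable_EFinP; apply: measurable_sum => i.
by apply: measurable_funX; exact: measurable_process_at.
Qed.

Let Psi : T * measurableTypeR R -> \bar R :=
  EFin \o ((fun z : T * measurableTypeR R => sqn (X z.1 z.2)) \_ TI).

Let mPsi : measurable_fun setT Psi.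
Proof.
apply/measurable_EFinP/(measurable_restrictT _ (@measurable_TI _ T R tf)).
by apply: measurable_sum => i; apply: measurable_funX; exact: mX.
Qed.

Let Psi0 z : (0 <= Psi z)%E.
Proof. by rewrite /Psi /= patchE; case: ifP => // _; rewrite lee_fin sqn_ge0. Qed.

Let energyE w : energy tf (X w) = fubini_F mu Psi w.
Proof.
apply: integral_support => [t tI _|t _ []//|t _ tI].
  by rewrite /Psi /= patchE mem_set.
by rewrite /Psi /= patchE memNset // => -[].
Qed.

Lemma measurable_energy : measurable_fun [set: T] (fun w => energy tf (X w)).
Proof.
have -> : (fun w => energy tf (X w)) = fubini_F mu Psi by apply/funext => w; exact: energyE.
exact: measurable_fun_fubini_tonelli_F.
Qed.

Lemma mean_energy_le c : (forall t, t \in `[0, tf] -> (\int[P]_w (sqn (X w t))%:E <= c%:E)%E) ->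
  (\int[P]_w energy tf (X w) <= (tf * c)%:E)%E.
Proof.
move=> Xc.
have -> : (\int[P]_w energy tf (X w) = \int[P]_w fubini_F mu Psi w)%E.
  by apply: eq_integral => w _; exact: energyE.
rewrite fubini_tonelli //.
have -> : (tf * c)%:E = (\int[mu]_(t in `[0%R, tf]) cst c%:E t)%E.
  by rewrite integral_cst //= mu_itv0 ?ltW // EFinM muleC.
have -> : (\int[mu]_t fubini_G P Psi t =
    \int[mu]_(t in `[0%R, tf]) fubini_G P Psi t)%E.
  apply: integral_support => // [t _ tI|t _ []//]; rewrite /fubini_G integral0_eq //.
  by move=> w _; rewrite /Psi /= patchE memNset // => -[].
have c0 : 0 <= c.
  have := Xc 0; rewrite in_itv /= lexx ltW // => /(_ isT); rewrite -lee_fin.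
  by apply: le_trans; apply: integral_ge0 => w _; rewrite lee_fin sqn_ge0.
apply: ge0_le_integral => //.
- by move=> t _; apply: integral_ge0.
- by apply: measurable_funTS; exact: measurable_fun_fubini_tonelli_G.
- move=> t tI; apply: le_trans (Xc t tI); rewrite le_eqVlt; apply/orP; left.
  by apply/eqP; apply: eq_integral => w _; rewrite /Psi /= patchE mem_set.
Qed.

Lemma entry_sq_integrable c t i : t \in `[0, tf] ->
  (\int[P]_w (sqn (X w t))%:E <= c%:E)%E ->
  sq_integrable P setT (fun w => X w t i 0).
Proof.
move=> tI Xc; split; first exact: measurable_process_at.
apply: (@le_lt_trans _ _ c%:E); last by rewrite ltry.
apply: le_trans Xc; apply: ge0_le_integral => //.
- by move=> w _; rewrite lee_fin sqr_ge0.
- by apply/measurable_EFinP; apply: measurable_funX; exact: measurable_process_at.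
- exact: measurable_sqn_at.
- by move=> w _; rewrite lee_fin sqr_le_sqn.
Qed.

Lemma entry_integrable c t i : t \in `[0, tf] ->
  (\int[P]_w (sqn (X w t))%:E <= c%:E)%E ->
  P.-integrable setT (EFin \o (fun w => X w t i 0)).
Proof.
move=> tI Xc; apply: sq_integrable_integrable => //.
  by apply: (@le_lt_trans _ _ 1%E); rewrite ?probability_le1 ?ltry.
exact: entry_sq_integrable Xc.
Qed.

End MeasurableEnergy.

Lemma second_order_ge0 c X : second_order c X -> 0 <= c.
Proof.
case=> _ _ Xc _; have := Xc 0; rewrite in_itv /= lexx ltW // => /(_ isT).
rewrite -lee_fin; apply: le_trans.
by apply: integral_ge0 => w _; rewrite lee_fin sqn_ge0.
Qed.

Lemma mean_linear_comb c X (a : 'I_m -> R) t : second_order c X -> t \in `[0, tf] ->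
  (\int[P]_w (\sum_j a j * X w t j 0)%:E = 0)%E.
Proof.
move=> [mX _ Xc X0] tI.
under eq_integral do rewrite -sumEFin.
rewrite integral_sum //; last first.
  move=> j; have := integrableZl measurableT (a j) (@entry_integrable X mX c t j tI (Xc t tI)).
  by [].
apply: big1 => j _; under eq_integral do rewrite EFinM.
rewrite integralZl //; last exact: entry_integrable (Xc t tI).
by rewrite -expectationE X0 // mule0.
Qed.

Lemma second_order_eq c X Y :
  (forall w t, t \in `[0, tf] -> X w t = Y w t) ->
  second_order c X -> second_order c Y.
Proof.
move=> XY [mX LX Xc X0]; split.
- exact: measurable_process_eq XY mX.
- by move=> w; apply: L2sig_eq (LX w) => t; exact: XY.
- move=> t tI; apply: le_trans (Xc t tI); rewrite le_eqVlt; apply/orP; left.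
  by apply/eqP; apply: eq_integral => w _; rewrite XY.
- move=> t tI i; rewrite -(X0 t tI i); congr expectation.
  by apply/funext => w; rewrite XY.
Qed.

Lemma second_order_mxop c X (M : 'M[R]_m) : second_order c X ->
  second_order (sqfrob M * c) (fun w => mxop M (X w)).
Proof.
move=> SX; have [mX LX Xc X0] := SX; split.
- exact: measurable_process_mxop.
- by move=> w; exact: L2sig_mxop.
- move=> t tI.
  apply: (@le_trans _ _ (\int[P]_w ((sqfrob M)%:E * (sqn (X w t))%:E))%E).
    apply: ge0_le_integral => //.
    - by move=> w _; rewrite lee_fin sqn_ge0.
    - by apply: (@measurable_sqn_at (fun w => mxop M (X w))) => //; exact: measurable_process_mxop.
    - by apply: measurable_funeM; exact: measurable_sqn_at.
    - by move=> w _; rewrite -EFinM lee_fin sqn_mulmx.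
  rewrite ge0_integralZl //; last 3 first.
  - exact: measurable_sqn_at.
  - by move=> w _; rewrite lee_fin sqn_ge0.
  - by rewrite lee_fin sqfrob_ge0.
  by rewrite EFinM lee_wpmul2l ?Xc // lee_fin sqfrob_ge0.
- move=> t tI i; rewrite expectationE -(mean_linear_comb (M i) SX tI).
  by apply: eq_integral => w _; rewrite mxE.
Qed.

Lemma second_order_add c c' X Y : second_order c X -> second_order c' Y ->
  second_order (2 * c + 2 * c') (fun w => X w \+ Y w).
Proof.
move=> [mX LX Xc X0] [mY LY Yc Y0]; split.
- exact: measurable_process_add.
- by move=> w; exact: L2sigD.
- move=> t tI.
  apply: (@le_trans _ _ (\int[P]_w (2%:E * (sqn (X w t))%:E + 2%:E * (sqn (Y w t))%:E))%E).
    apply: ge0_le_integral => //.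
    - by move=> w _; rewrite lee_fin sqn_ge0.
    - by apply: (@measurable_sqn_at (fun w => X w \+ Y w)) => //; exact: measurable_process_add.
    - by apply: emeasurable_funD; apply: measurable_funeM; exact: measurable_sqn_at.
    - move=> w _; rewrite -!EFinM -EFinD lee_fin.
      by have := sqnD_le (X w t) (Y w t) (@ltr01 R); rewrite invr1.
  rewrite ge0_integralD //;
    try (by move=> w _; rewrite -EFinM lee_fin mulr_ge0 ?sqn_ge0);
    try (by apply: measurable_funeM; exact: measurable_sqn_at).
  rewrite !ge0_integralZl //; try exact: measurable_sqn_at;
    try (by move=> w _; rewrite lee_fin sqn_ge0).
  by rewrite (EFinD (2 * c)) !EFinM leeD // lee_wpmul2l ?Xc ?Yc.
- move=> t tI i; rewrite expectationE.
  under eq_integral do rewrite mxE EFinD.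
  rewrite integralD //; [|exact: entry_integrable (Xc t tI)|exact: entry_integrable (Yc t tI)].
  by rewrite -!expectationE X0 // Y0 // adde0.
Qed.

Lemma second_order_revop c X : second_order c X ->
  second_order c (fun w => revop tf (X w)).
Proof.
have rI t : t \in `[0, tf] -> tf - t \in `[0, tf] by rewrite !in_itv /=; lra.
move=> [mX LX Xc X0]; split.
- exact: measurable_process_revop.
- by move=> w; exact: L2sig_revop.
- by move=> t /rI; exact: Xc.
- by move=> t /rI tI i; exact: X0.
Qed.

Section VolterraProcess.
Variables (k : R -> 'M[R]_m) (kap : R).
Hypothesis mk : forall i j, measurable_fun [set: R] (fun t => k t i j).
Hypothesis kb : forall t, t \in `[0, tf] -> sqfrob (k t) <= kap.
Variables (c : R) (X : T -> signal R m).
Hypothesis SX : second_order c X.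

(** The pointwise bound by the path energy, averaged over the outcomes. *)
Lemma mean_volterra_le t : t \in `[0, tf] ->
  (\int[P]_w (sqn (volterra k (X w) t))%:E <= (tf ^+ 2 * kap * c)%:E)%E.
Proof.
move=> tI; have [mX LX Xc X0] := SX.
have tk0 : 0 <= tf * kap by rewrite mulr_ge0 ?(kap_ge0 tf0 kb) ?ltW.
apply: (@le_trans _ _ (\int[P]_w ((tf * kap)%:E * energy tf (X w)))%E).
  apply: ge0_le_integral => //.
  - by move=> w _; rewrite lee_fin sqn_ge0.
  - by apply: (@measurable_sqn_at (fun w => volterra k (X w))) => //; exact: measurable_process_volterra.
  - by apply: measurable_funeM; exact: measurable_energy.
  - by move=> w _; exact: (sqn_volterra_le tf0 mk kb).
rewrite ge0_integralZl //; last 2 first.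
- exact: measurable_energy.
- by move=> w _; exact: energy_ge0.
have -> : tf ^+ 2 * kap * c = (tf * kap) * (tf * c) by ring.
by rewrite (EFinM (tf * kap)) lee_wpmul2l ?lee_fin // mean_energy_le.
Qed.

(** Fubini: the mean of the convolution is the convolution of the mean. *)
Lemma zero_mean_volterra : zero_mean P tf (fun w => volterra k (X w)).
Proof.
move=> t tI i; have [mX LX Xc X0] := SX.
pose It : measurableTypeR R -> R := \1_(`[0, t]%classic).
pose Xt j := (fun z : T * measurableTypeR R => X z.1 z.2 j 0) \_ TI.
pose Phi (z : T * measurableTypeR R) : R :=
  It z.2 * \sum_j k (t - z.2) i j * Xt j z.
have mXt j : measurable_fun setT (Xt j).
  by apply/(measurable_restrictT _ (@measurable_TI _ T R tf)); exact: mX.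
have mPhi : measurable_fun setT Phi.
  apply: measurable_funM.
    apply: (@measurableT_comp _ _ _ _ _ _ It) => //.
    by apply: measurable_indic; exact: measurable_itv.
  apply: measurable_sum => j; apply: measurable_funM; last exact: mXt.
  apply: (measurableT_comp (mk i j)).
  by apply: measurable_funB.
have subI tau : tau \in `[0, t] -> tau \in `[0, tf] /\ t - tau \in `[0, tf].
  by move: tI; rewrite !in_itv /=; split; lra.
have PhiE w tau : tau \in `[0, t] -> Phi (w, tau) = (k (t - tau) *m X w tau) i 0.
  move=> tauI; rewrite /Phi /It indicE mem_set // mul1r mxE.
  apply: eq_bigr => j _; rewrite /Xt patchE mem_set //.
  by split=> //=; have [] := subI _ tauI.
have Phi0 w tau : ~ (tau \in `[0, t]) -> Phi (w, tau) = 0.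
  by move=> tauI; rewrite /Phi /It indicE memNset ?mul0r.
(* |y| <= 1 + y^2 turns the second moments into an integrable bound. *)
have iPhi : (P \x mu)%E.-integrable setT (EFin \o Phi).
  have mE : measurable_fun setT (EFin \o Phi) by exact/measurable_EFinP.
  apply/(integrable21ltyP P mu) => //.
  have muE : (\int[mu]_y \int[P]_x `|(EFin \o Phi) (x, y)| =
     \int[mu]_(y in `[0%R, t]) \int[P]_x `|(EFin \o Phi) (x, y)|)%E.
    apply: integral_support => // [tau _ tauI|tau _ []//].
    by rewrite integral0_eq // => w _; rewrite /= Phi0 // normr0.
  rewrite muE; apply: (@le_lt_trans _ _ (\int[mu]_(y in `[0%R, t]) cst (1 + kap * c)%:E y)%E).
    apply: ge0_le_integral => //.
    - by move=> tau _; apply: integral_ge0.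
    - apply: measurable_funTS.
      have := @measurable_fun_fubini_tonelli_G _ _ _ _ R P (fun p => `|(EFin \o Phi) p|%E).
      by apply => //; exact: measurableT_comp.
    - move=> tau tauI /=; have [tauI1 tauI2] := subI _ tauI.
      apply: (@le_trans _ _ (\int[P]_w (1%:E + kap%:E * (sqn (X w tau))%:E))%E).
        apply: ge0_le_integral => //.
        - have m1 : measurable_fun setT (fun w => Phi (w, tau)).
            exact: (measurableT_comp mPhi (pair2_measurable _)).
          by apply: measurableT_comp => //; exact: measurableT_comp m1.
        - apply: emeasurable_funD => //; apply: measurable_funeM.
          exact: measurable_sqn_at.
        - move=> w _; rewrite -EFinM -EFinD lee_fin PhiE //.
          set y := k (t - tau) *m X w tau.
          apply: (@le_trans _ _ (1 + sqn y)).
            have := sqr_le_sqn y i; set a := y i 0 => ay.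
            apply: le_trans (_ : _ <= 1 + a ^+ 2) _; last by rewrite lerD2l.
            rewrite -(real_normK (num_real a)).
            by have := sqr_ge0 (`|a| - 1); have := normr_ge0 a; nra.
          rewrite lerD2l; apply: le_trans (sqn_mulmx _ _) _.
          by rewrite ler_wpM2r ?sqn_ge0 ?kb.
      have k0 := kap_ge0 tf0 kb.
      rewrite ge0_integralD //;
        try (by move=> w _; rewrite -EFinM lee_fin mulr_ge0 ?sqn_ge0);
        try (by apply: measurable_funeM; exact: measurable_sqn_at).
      rewrite integral_cst // ge0_integralZl //; try exact: measurable_sqn_at;
        try (by move=> w _; rewrite lee_fin sqn_ge0).
      have P1 : (1 * P setT = 1)%E by rewrite mul1e; exact: probability_setT.
      by rewrite P1 EFinD (EFinM kap) leeD2l // lee_wpmul2l ?Xc.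
  rewrite integral_cst //= mu_itv0 -?EFinM ?ltry //.
  by move: tI; rewrite in_itv /= => /andP[].
rewrite expectationE.
have volterraE w : ((volterra k (X w) t i 0)%:E = \int[mu]_tau (Phi (w, tau))%:E)%E.
  rewrite /volterra /int_sig mxE /Rintegral fineK; last first.
    by apply: integrable_fin_num => //; exact: (kernel_row_integrable tf0 mk kb).
  apply: integral_support => [tau tauI _|tau _ []//|tau _ tauI].
    by rewrite PhiE.
  by rewrite Phi0.
under eq_integral do rewrite volterraE.
apply: (etrans (Fubini iPhi)).
apply: integral0_eq => tau _ /=.
have [tauI|tauI] := boolP (tau \in `[0, t]); last first.
  by apply: integral0_eq => w _; rewrite Phi0 //; exact/negP.
have [tauI1 _] := subI _ tauI.
under eq_integral do rewrite PhiE // mxE.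
exact: mean_linear_comb SX tauI1.
Qed.

Lemma second_order_volterra : second_order (tf ^+ 2 * kap * c) (fun w => volterra k (X w)).
Proof.
have [mX LX Xc X0] := SX; split.
- exact: measurable_process_volterra.
- by move=> w; exact: (L2sig_volterra tf0 mk kb).
- exact: mean_volterra_le.
- exact: zero_mean_volterra.
Qed.

End VolterraProcess.

End SecondOrder.

(** * The induced operator norm *)

Section OperatorNorm.
Variables (R : realType) (tf : R) (m : nat).
Hypothesis tf0 : 0 < tf.

(** Normalize u to unit norm; the a priori bound c makes the supremum that
    defines the norm finite, and also settles signals of zero energy, which
    cannot be normalized. *)
Lemma opnormP (F : signal R m -> signal R m) (c : R) :
  (forall u, L2sig tf u -> L2sig tf (F u)) ->
  (forall a u, L2sig tf u -> forall t, t \in `[0, tf] ->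
     F (fun s => a *: u s) t = a *: F u t) ->
  (forall u, L2sig tf u -> (energy tf (F u) <= c%:E * energy tf u)%E) ->
  forall u, L2sig tf u -> (energy tf (F u) <= (opnorm tf F ^+ 2)%:E * energy tf u)%E.
Proof.
move=> FL FZ Fc u Hu.
have Hu' := FL _ Hu.
have n0 (v : signal R m) : 0 <= fine (energy tf v) by exact/fine_ge0/energy_ge0.
pose c' := Num.max c 0.
have Fc' v : L2sig tf v -> fine (energy tf (F v)) <= c' * fine (energy tf v).
  move=> Hv; apply: (@le_trans _ _ (c * fine (energy tf v))).
    rewrite -lee_fin EFinM (fineK (energy_fin_num Hv)) (fineK (energy_fin_num (FL _ Hv))).
    exact: Fc.
  by rewrite ler_wpM2r // le_max lexx.
have le_op v : L2sig tf v -> L2norm tf v <= 1 -> L2norm tf (F v) <= opnorm tf F.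
  move=> Hv v1; apply: ub_le_sup; last by exists v.
  exists (Num.sqrt c') => _ [w [Hw w1] <-].
  rewrite L2norm_energy; apply: ler_wsqrtr.
  apply: le_trans (Fc' _ Hw) _; rewrite ler_piMr ?le_max ?lexx ?orbT //.
  by move: w1; rewrite L2norm_energy -{1}sqrtr1 ler_sqrt.
rewrite -(fineK (energy_fin_num Hu)) -(fineK (energy_fin_num Hu')) -EFinM lee_fin.
have [u0|un0] := eqVneq (fine (energy tf u)) 0.
  by have := Fc' _ Hu; rewrite u0 !mulr0.
have upos : 0 < fine (energy tf u) by rewrite lt0r un0 n0.
set s := Num.sqrt (fine (energy tf u)).
have s0 : 0 < s by rewrite sqrtr_gt0.
have s2 : s ^+ 2 = fine (energy tf u) by rewrite sqr_sqrtr.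
have [mu' nu] := (L2sigP _ u).1 Hu.
have [mFu nFu] := (L2sigP _ (F u)).1 Hu'.
pose v : signal R m := fun t => s^-1 *: u t.
have Hv : L2sig tf v by exact: L2sigZ.
have v1 : L2norm tf v <= 1.
  rewrite L2norm_energy energyZ // fineM ?energy_fin_num //= -s2 -exprMn mulVf ?lt0r_neq0 //.
  by rewrite expr1n sqrtr1.
have := le_op v Hv v1.
have -> : L2norm tf (F v) = s^-1 * L2norm tf (F u).
  rewrite !L2norm_energy (energy_eq (FZ s^-1 u Hu)) energyZ // fineM ?energy_fin_num //=.
  by rewrite sqrtrM ?sqr_ge0 // sqrtr_sqr ger0_norm // invr_ge0 ltW.
rewrite mulrC ler_pdivrMr // => le1.
have L0 : 0 <= L2norm tf (F u) by rewrite L2norm_energy sqrtr_ge0.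
have : L2norm tf (F u) ^+ 2 <= (opnorm tf F * s) ^+ 2.
  by rewrite lerXn2r ?nnegrE //; apply: le_trans le1.
by rewrite exprMn s2 L2norm_energy sqr_sqrtr.
Qed.

Lemma integrable_dotv (u v : signal R m) : L2sig tf u -> L2sig tf v ->
  (@lebesgue_measure R).-integrable `[0, tf] (fun t => (dotv (u t) (v t))%:E).
Proof.
move=> Hu Hv.
have -> : (fun t => (dotv (u t) (v t))%:E) = (fun t => \sum_i (u t i 0 * v t i 0)%:E)%E.
  by apply/funext => t; rewrite sumEFin.
apply: integrable_sum => // i.
move=> _; apply: (sq_integrableM _ (@L2sig_entry R tf m u i Hu)
  (@L2sig_entry R tf m v i Hv)).
exact: measurable_itv.
Qed.

End OperatorNorm.

(** * The impulse response of the system *)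

Section SystemKernel.
Variables (R : realType) (n m : nat) (sys : system R n m) (tf : R).
Hypothesis tf0 : 0 < tf.

Definition impulse t : 'M[R]_m := sysC sys *m expmx (t *: sysA sys) *m sysB sys.

Lemma impulse_sum t i j :
  impulse t i j = \sum_q \sum_p sysC sys i p * expmx (t *: sysA sys) p q * sysB sys q j.
Proof.
rewrite mxE; apply: eq_bigr => q _; rewrite mxE mulr_suml.
by apply: eq_bigr => p _.
Qed.

Lemma measurable_impulse i j : measurable_fun [set: R] (fun t => impulse t i j).
Proof.
under eq_fun do rewrite impulse_sum.
apply: measurable_sum => q; apply: measurable_sum => p.
apply: measurable_funM => //; apply: measurable_funM => //.
exact: measurable_expmx_entry.
Qed.

Lemma sqfrob_bounded p q (M : R -> 'M[R]_(p, q)) (b : 'I_p -> 'I_q -> R) :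
  (forall t, t \in `[0, tf] -> forall i j, `|M t i j| <= b i j) ->
  forall t, t \in `[0, tf] -> sqfrob (M t) <= \sum_i \sum_j b i j ^+ 2.
Proof.
move=> Mb t tI; apply: ler_sum => i _; apply: ler_sum => j _.
rewrite -(real_normK (num_real _)) lerXn2r ?nnegrE ?Mb //.
exact: le_trans (Mb t tI i j).
Qed.

Lemma impulse_bounded : exists kap, forall t, t \in `[0, tf] -> sqfrob (impulse t) <= kap.
Proof.
have [c Hc] := expmx_entry_bounded (sysA sys) tf.
exists (\sum_i \sum_j (\sum_q \sum_p `|sysC sys i p| * c * `|sysB sys q j|) ^+ 2).
apply: sqfrob_bounded => // t tI i j; rewrite impulse_sum.
apply: (le_trans (ler_norm_sum _ _ _)); apply: ler_sum => q _.
apply: (le_trans (ler_norm_sum _ _ _)); apply: ler_sum => p _.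
rewrite !normrM ler_wpM2r // ler_wpM2l // Hc //.
by move: tI; rewrite in_itv /= => /andP[t0 t1]; rewrite ger0_norm.
Qed.

Lemma L2sig_free_response x0 : L2sig tf (free_response sys x0).
Proof.
have frE t i : free_response sys x0 t i 0 =
    \sum_q \sum_p sysC sys i p * expmx (t *: sysA sys) p q * x0 q 0.
  rewrite mxE; apply: eq_bigr => q _; rewrite mxE mulr_suml.
  by apply: eq_bigr => p _.
have [c Hc] := expmx_entry_bounded (sysA sys) tf.
apply: (@L2sig_bounded _ _ tf0 _ _ (\sum_i
   (\sum_q \sum_p `|sysC sys i p| * c * `|x0 q 0|) ^+ 2)).
  move=> i; have -> : (fun t => free_response sys x0 t i 0) = (fun t =>
      \sum_q \sum_p sysC sys i p * expmx (t *: sysA sys) p q * x0 q 0).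
    by apply/funext => t; rewrite frE.
  apply: measurable_sum => q; apply: measurable_sum => p.
  apply: measurable_funM => //; apply: measurable_funM => //.
  apply: measurable_funTS; exact: measurable_expmx_entry.
move=> t tI; apply: ler_sum => i _.
have H : `|free_response sys x0 t i 0| <= \sum_q \sum_p `|sysC sys i p| * c * `|x0 q 0|.
  rewrite frE.
  apply: (le_trans (ler_norm_sum _ _ _)); apply: ler_sum => q _.
  apply: (le_trans (ler_norm_sum _ _ _)); apply: ler_sum => p _.
  rewrite !normrM ler_wpM2r // ler_wpM2l // Hc //.
  by move: tI; rewrite in_itv /= => /andP[t0 t1]; rewrite ger0_norm.
rewrite -(real_normK (num_real _)) lerXn2r ?nnegrE //.
exact: le_trans H.
Qed.

Lemma signature_mxP (Sig : 'M[R]_m) : signature_mx Sig ->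
  Sig^T = Sig /\ Sig *m Sig = 1%:M.
Proof.
move=> [/is_diag_mxP dg pm].
have ST : Sig^T = Sig.
  apply/matrixP => i j; rewrite mxE; have [->//|ij] := eqVneq i j.
  by rewrite !dg // eq_sym.
split=> //; apply/matrixP => i j; rewrite !mxE (bigD1 i) //= big1 ?addr0; last first.
  by move=> l li; rewrite (dg i l) ?mul0r // eq_sym.
have [<-|ij] := eqVneq i j; last by rewrite (dg i j) ?mulr0.
by case: (pm i) => ->; rewrite ?mulr1 ?mulrNN ?mulr1.
Qed.

Variable Sig : 'M[R]_m.
Hypothesis sys_sym : externally_symmetric sys Sig.

(** Conjugation by Sig, which is its own inverse. *)
Lemma sym_swap (M : 'M[R]_m) : Sig *m M^T = M *m Sig -> Sig *m M = M^T *m Sig.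
Proof.
have [_ SS] := signature_mxP sys_sym.1.
move=> H; rewrite -[RHS]mul1mx -SS -!mulmxA (mulmxA Sig M^T) H -!mulmxA SS.
by rewrite mulmx1.
Qed.

(** All Markov parameters C A^j B are symmetric, hence so is every linear
    combination of powers of A between C and B, and so is the limit. *)
Lemma impulse_sym t : Sig *m impulse t = (impulse t)^T *m Sig.
Proof.
apply: sym_swap; apply/eqP; rewrite -subr_eq0; apply/eqP/matrixP => i j.
have [_ Hm] := markov_symmetric sys_sym.
pose f (M : 'M[R]_n) : R := (sym_defect (sysB sys) (sysC sys) Sig M) i j.
have flin : linear f by move=> a M N; rewrite /f linearP !mxE.
pose fL := GRing.isLinear.Build R 'M[R]_n R *:%R f flin.
pose fl : {linear 'M[R]_n -> R} := HB.pack f fL.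
rewrite [RHS]mxE; apply: (@expmx_linear_eq0 R n (t *: sysA sys) fl) => l.
by rewrite mxpowZ linearZ /= /f Hm mxE scaler0.
Qed.

Lemma sysD_sym : Sig *m sysD sys = (sysD sys)^T *m Sig.
Proof. by apply: sym_swap; have [] := markov_symmetric sys_sym. Qed.

End SystemKernel.

(** * Operators on signals and on processes *)

Section SignalOperators.
Context d (T : measurableType d) (R : realType) (P : probability T R).
Variables (tf : R) (m : nat).
Hypothesis tf0 : 0 < tf.

(** Everything that the iteration requires of a linear operator on signals, for
    paths and for processes at once, with one constant C for the energy and for
    the second moments.  F is a function on representatives of signals, so
    congruence on [0, tf] and linearity are stated instant by instant. *)
Record signal_op (F : signal R m -> signal R m) (C : R) : Prop := SignalOp {
  op_ge0 : 0 <= C;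
  op_eq : forall u v, (forall t, t \in `[0, tf] -> u t = v t) ->
    forall t, t \in `[0, tf] -> F u t = F v t;
  op_L2 : forall u, L2sig tf u -> L2sig tf (F u);
  opD : forall u v, L2sig tf u -> L2sig tf v ->
    forall t, t \in `[0, tf] -> F (u \+ v) t = F u t + F v t;
  opZ : forall a u, L2sig tf u ->
    forall t, t \in `[0, tf] -> F (fun s => a *: u s) t = a *: F u t;
  op_energy : forall u, L2sig tf u -> (energy tf (F u) <= C%:E * energy tf u)%E;
  op_meas : forall X : T -> signal R m, measurable_process tf X ->
    measurable_process tf (fun w => F (X w));
  op_so : forall c X, second_order P tf c X ->
    second_order P tf (C * c) (fun w => F (X w)) }.

Lemma signal_op_mxop (M : 'M[R]_m) : signal_op (mxop M) (sqfrob M).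
Proof.
split.
- exact: sqfrob_ge0.
- by move=> u v uv t tI; rewrite /mxop uv.
- by move=> u; exact: L2sig_mxop.
- by move=> u v _ _ t _; rewrite /mxop mulmxDr.
- by move=> a u _ t _; rewrite /mxop scalemxAr.
- by move=> u /L2sigP[mu' _]; exact: energy_mxop.
- by move=> X; exact: measurable_process_mxop.
- by move=> c X; exact: second_order_mxop.
Qed.

Lemma signal_op_revop : signal_op (@revop R tf m) 1.
Proof.
split=> //.
- move=> u v uv t tI; apply: uv; move: tI; rewrite !in_itv /=; lra.
- by move=> u; exact: L2sig_revop.
- by move=> u /L2sigP[mu' _]; rewrite energy_revop // mul1e.
- by move=> X; exact: measurable_process_revop.
- by move=> c X; rewrite mul1r; exact: second_order_revop.
Qed.

Lemma signal_op_volterra (k : R -> 'M[R]_m) kap :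
  (forall i j, measurable_fun [set: R] (fun t => k t i j)) ->
  (forall t, t \in `[0, tf] -> sqfrob (k t) <= kap) ->
  signal_op (volterra k) (tf ^+ 2 * kap).
Proof.
move=> mk kb; split.
- by rewrite mulr_ge0 ?sqr_ge0 ?(kap_ge0 tf0 kb).
- by move=> u v uv t tI; exact: volterra_eq uv _ tI.
- by move=> u; exact: (L2sig_volterra tf0 mk kb).
- by move=> u v Hu Hv t tI; exact: (volterraD tf0 mk kb).
- by move=> a u Hu t tI; exact: (volterraZ tf0 mk kb).
- by move=> u Hu; exact: (energy_volterra_le tf0 mk kb).
- by move=> X; exact: measurable_process_volterra.
- by move=> c X; exact: (second_order_volterra tf0 mk kb).
Qed.

Lemma signal_op_comp F G C D : signal_op F C -> signal_op G D ->
  signal_op (fun u => F (G u)) (C * D).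
Proof.
move=> HF HG; split.
- by rewrite mulr_ge0 ?(op_ge0 HF) ?(op_ge0 HG).
- by move=> u v uv; apply: (op_eq HF); exact: (op_eq HG uv).
- by move=> u /(op_L2 HG)/(op_L2 HF).
- move=> u v Hu Hv t tI; rewrite -(opD HF) ?(op_L2 HG) //; try exact: (op_L2 HG).
  by apply: (op_eq HF) => // s sI; rewrite (opD HG).
- move=> a u Hu t tI; rewrite -(opZ HF) //; last exact: (op_L2 HG).
  by apply: (op_eq HF) => // s sI; rewrite (opZ HG).
- move=> u Hu; apply: le_trans (op_energy HF (op_L2 HG Hu)) _.
  by rewrite EFinM -muleA lee_wpmul2l ?lee_fin ?(op_ge0 HF) // (op_energy HG).
- by move=> X /(op_meas HG)/(op_meas HF).
- by move=> c X /(op_so HG)/(op_so HF); rewrite mulrA.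
Qed.

Lemma signal_op_add F G C D : signal_op F C -> signal_op G D ->
  signal_op (fun u => F u \+ G u) (2 * C + 2 * D).
Proof.
move=> HF HG; have C0 := op_ge0 HF; have D0 := op_ge0 HG; split.
- lra.
- by move=> u v uv t tI /=; rewrite (op_eq HF uv tI) (op_eq HG uv tI).
- by move=> u Hu; apply: L2sigD; [exact: (op_L2 HF)|exact: (op_L2 HG)].
- by move=> u v Hu Hv t tI /=; rewrite (opD HF) // (opD HG) // addrACA.
- by move=> a u Hu t tI /=; rewrite (opZ HF) // (opZ HG) // scalerDr.
- move=> u Hu; have [mF _] := (L2sigP _ _).1 (op_L2 HF Hu).
  have [mG _] := (L2sigP _ _).1 (op_L2 HG Hu).
  apply: le_trans (energyD_le ltr01 mF mG) _; rewrite invr1.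
  have nu := energy_fin_num Hu; rewrite -(fineK nu).
  have := op_energy HF Hu; have := op_energy HG Hu.
  rewrite -(fineK nu) -(fineK (energy_fin_num (op_L2 HF Hu))).
  rewrite -(fineK (energy_fin_num (op_L2 HG Hu))) -!EFinM -EFinD !lee_fin.
  lra.
- move=> X mX; apply: measurable_process_add; first exact: (op_meas HF).
  exact: (op_meas HG).
- move=> c X SX; have -> : (2 * C + 2 * D) * c = 2 * (C * c) + 2 * (D * c) by ring.
  by apply: second_order_add; [exact: (op_so HF)|exact: (op_so HG)].
Qed.

Lemma signal_op_scale a : signal_op (fun u t => a *: u t) (sqfrob (a%:M : 'M[R]_m)).
Proof.
suff -> : (fun u t => a *: u t) = mxop (a%:M : 'M[R]_m) by exact: signal_op_mxop.
by apply/funext => u; apply/funext => t; rewrite /mxop mul_scalar_mx.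
Qed.

End SignalOperators.

(** * The instantaneous part of a contraction *)

Section Localization.
Variables (R : realType) (tf : R) (m : nat).
Hypothesis tf0 : 0 < tf.
Notation mu := (@lebesgue_measure R).

(** Apply the contraction to the signal equal to v on [0, e] and to 0 afterwards.
    Its energy is e |v|^2, so K differs from K0 on it by O(sqrt e) pointwise;
    dividing by e and letting e tend to 0 leaves the inequality for K0. *)
Lemma contraction_instantaneous_part (K : signal R m -> signal R m) (K0 Y : 'M[R]_m) (c rho : R) :
  0 <= c -> 0 <= rho ->
  (forall u, L2sig tf u -> L2sig tf (K u)) ->
  (forall u, L2sig tf u -> forall t, t \in `[0, tf] ->
     ((sqn (K u t - K0 *m u t))%:E <= c%:E * energy tf u)%E) ->
  (forall u, L2sig tf u ->
     (energy tf (mxop Y (K u)) <= rho%:E * energy tf (mxop Y u))%E) ->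
  forall v, sqn (Y *m (K0 *m v)) <= rho * sqn (Y *m v).
Proof.
move=> c0 rho0 KL Kr Krho v.
set a := sqn (Y *m (K0 *m v)); set b := rho * sqn (Y *m v).
pose c' := sqfrob Y * (c * sqn v).
have c'0 : 0 <= c' by rewrite !mulr_ge0 ?sqfrob_ge0 ?sqn_ge0.
have b0 : 0 <= b by rewrite mulr_ge0 ?sqn_ge0.
(* The squared error c' e of replacing K by K0 is separated by means of a
   parameter dl; e tends to 0 first, for fixed dl, and then dl tends to 0. *)
have key e dl : 0 < e <= tf -> 0 < dl ->
    a <= (1 + dl) * b + (1 + dl^-1) * (c' * e).
  move=> /andP[e0 etf] dl0.
  have dl1 : 0 < dl^-1 by rewrite invr_gt0.
  pose u : signal R m := fun t => if t \in `[0, e] then v else 0.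
  have uE i : (fun t => u t i 0) = (fun t => v i 0 * \1_(`[0, e]%classic) t).
    apply/funext => t; rewrite /u indicE mem_setE; case: ifP => _.
      by rewrite mulr1.
    by rewrite mxE mulr0.
  have mu' : measurable_sig tf u.
    by move=> i; rewrite uE; apply: measurable_funM.
  have Hu : L2sig tf u.
    apply: (@L2sig_bounded _ _ tf0 _ _ (sqn v)) => // t _.
    by rewrite /u; case: ifP => _ //; rewrite sqn0 sqn_ge0.
  have energyMu (M : 'M[R]_m) : energy tf (mxop M u) = (e * sqn (M *m v))%:E.
    have -> : (e * sqn (M *m v))%:E =
        (\int[mu]_(t in `[0%R, e]) cst (sqn (M *m v))%:E t)%E.
      by rewrite integral_cst //= mu_itv0 ?ltW // EFinM muleC.
    apply: integral_support => [t _ te|t _ te|t te].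
    - by rewrite /mxop /u ifT.
    - by rewrite /mxop /u ifF ?mulmx0 ?sqn0 //; exact/negP.
    - by move=> tI; exfalso; apply: tI; move: te; rewrite /= !in_itv /=; lra.
  have energyu : energy tf u = (e * sqn v)%:E.
    have -> : energy tf u = energy tf (mxop 1%:M u).
      by apply: energy_eq => t _; rewrite /mxop mul1mx.
    by rewrite energyMu mul1mx.
  have [mK nK] := (L2sigP _ _).1 (KL _ Hu).
  have mYK := @measurable_sig_mxop _ tf _ _ Y _ mK.
  have pt t : t \in `[0, e] ->
      a <= (1 + dl) * sqn (Y *m K u t) + (1 + dl^-1) * (c' * e).
    move=> te; have tI : t \in `[0, tf] by move: te; rewrite !in_itv /=; lra.
    have -> : a = sqn (Y *m K u t + (- 1) *: (Y *m (K u t - K0 *m u t))).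
      by rewrite /a mulmxBr scaleN1r opprB addrCA subrr addr0 /u te.
    apply: le_trans (sqnD_le _ _ dl0) _; rewrite lerD2l ler_pM2l; last by lra.
    rewrite sqnZ sqrrN expr1n mul1r; apply: le_trans (sqn_mulmx _ _) _.
    rewrite /c' -mulrA ler_wpM2l ?sqfrob_ge0 //.
    have := Kr u Hu t tI; rewrite energyu -EFinM lee_fin.
    by rewrite -mulrA (mulrC e).
  have : (\int[mu]_(t in `[0%R, e]) cst a%:E t <=
     \int[mu]_(t in `[0%R, e]) ((1 + dl)%:E * (sqn (Y *m K u t))%:E +
       cst ((1 + dl^-1) * (c' * e))%:E t))%E.
    have mS : measurable_fun `[0, e] (fun t => (sqn (Y *m K u t))%:E).
      apply: measurable_funS (measurable_sqn mYK) => //.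
      by move=> t /=; rewrite !in_itv /=; lra.
    apply: ge0_le_integral => //.
    - by move=> t _; rewrite lee_fin sqn_ge0.
    - by apply: emeasurable_funD => //; apply: measurable_funeM.
  have mS : measurable_fun `[0, e] (fun t => (sqn (Y *m K u t))%:E).
    apply: measurable_funS (measurable_sqn mYK) => //.
    by move=> t /=; rewrite !in_itv /=; lra.
  have k0 : 0 <= (1 + dl^-1) * (c' * e).
    by rewrite mulr_ge0 //; [lra|rewrite mulr_ge0 // ltW].
  rewrite ge0_integralD //;
    try (by move=> t _; rewrite -EFinM lee_fin mulr_ge0 ?sqn_ge0 //; lra);
    try (by move=> t _; rewrite /= lee_fin);
    try (by apply: measurable_funeM).
  rewrite ge0_integralZl //;
    try (by move=> t _; rewrite lee_fin sqn_ge0); try (by rewrite lee_fin; lra).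
  rewrite !integral_cst //= (mu_itv0 (ltW e0)).
  have sub : (\int[mu]_(t in `[0%R, e]) (sqn (Y *m K u t))%:E <= (b * e)%:E)%E.
    apply: (@le_trans _ _ (energy tf (mxop Y (K u)))).
      apply: ge0_subset_integral => //.
      + exact: measurable_sqn mYK.
      + by move=> t _; rewrite lee_fin sqn_ge0.
      + by move=> t /=; rewrite !in_itv /=; lra.
    apply: le_trans (Krho u Hu) _; rewrite energyMu -EFinM lee_fin /b.
    by rewrite mulrCA mulrC.
  have dlE : (0 <= (1 + dl)%:E)%E by rewrite lee_fin; lra.
  move=> H; have := le_trans H (leeD2r _ (lee_wpmul2l dlE sub)).
  rewrite -!EFinM -EFinD lee_fin.
  by rewrite mulrA -mulrDl ler_pM2r.
have key2 dl : 0 < dl -> a <= (1 + dl) * b.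
  move=> dl0; apply/ler_addgt0Pr => x x0.
  pose L := (1 + dl^-1) * c'.
  have L0 : 0 <= L.
    by rewrite mulr_ge0 // addr_ge0 // invr_ge0 ltW.
  pose e := Num.min tf (x / (L + 1)).
  have e0 : 0 < e by rewrite lt_min tf0 divr_gt0 //; lra.
  have eI : 0 < e <= tf by rewrite e0 ge_min lexx.
  apply: le_trans (key e dl eI dl0) _; rewrite lerD2l mulrA -/L.
  have : e <= x / (L + 1) by rewrite ge_min lexx orbT.
  have L1 : 0 < L + 1 by lra.
  rewrite ler_pdivlMr //; nra.
apply/ler_addgt0Pr => x x0.
have b1 : 0 < b + 1 by lra.
apply: le_trans (key2 (x / (b + 1)) _) _; first by rewrite divr_gt0.
by rewrite mulrDl mul1r lerD2l mulrAC ler_pdivrMr //; nra.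
Qed.

End Localization.

(** * The contraction behind the iteration *)

Section Iteration.
Context d (T : measurableType d) (R : realType) (P : probability T R).
Variables (n m : nat) (sys : system R n m) (Sig Q W : 'M[R]_m) (tf : R).
Hypothesis tf0 : 0 < tf.
Notation mu := (@lebesgue_measure R).
Notation D := (sysD sys).
Notation k := (impulse sys).
Notation N0 := (- (invmx W *m Sig)).

(** The map - W^(-1) Sig J G Sig Q J.  J commutes with constant matrices
    and Sig J G J Sig is the adjoint of G, so this is - W^(-1) G* Q.  All
    the maps of the iteration factor through it. *)
Definition adjoint_step (z : signal R m) : signal R m :=
  mxop N0 (revop tf (Gop sys (mxop (Sig *m Q) (revop tf z)))).

Lemma GopE (u : signal R m) : Gop sys u = volterra k u \+ mxop D u.
Proof. by []. Qed.

Lemma SopE (u : signal R m) : Sop tf sys Sig Q W u = adjoint_step (Gop sys u).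
Proof. by []. Qed.

Lemma Gop_op : exists C, signal_op P tf (Gop sys) C.
Proof.
have [kap kb] := impulse_bounded sys tf.
exists (2 * (tf ^+ 2 * kap) + 2 * sqfrob D).
apply: signal_op_add => //.
  exact: (signal_op_volterra P tf0 (fun i j => measurable_impulse sys i j) kb).
exact: signal_op_mxop.
Qed.

Lemma adjoint_step_op : exists C, signal_op P tf adjoint_step C.
Proof.
have [C GC] := Gop_op.
exists (sqfrob N0 * (1 * (C * (sqfrob (Sig *m Q) * 1)))).
have J := signal_op_revop P tf m.
apply: (signal_op_comp (signal_op_mxop P tf N0)).
apply: (signal_op_comp J); apply: (signal_op_comp GC).
exact: (signal_op_comp (signal_op_mxop P tf (Sig *m Q)) J).
Qed.

Lemma Sop_op : exists C, signal_op P tf (Sop tf sys Sig Q W) C.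
Proof.
have [C GC] := Gop_op; have [C' HC] := adjoint_step_op.
by exists (C' * C); exact: (signal_op_comp HC GC).
Qed.

(** The matrix by which S acts when the integral part of G is dropped from both
    experiments; the two time reversals cancel. *)
Definition feedthrough : 'M[R]_m := N0 *m (D *m ((Sig *m Q) *m D)).

(** Each of the two applications of G consists of a convolution and of D.  All
    terms of S that contain at least one convolution are bounded pointwise by the
    energy. *)
Lemma Sop_split : exists2 c, 0 <= c & forall u, L2sig tf u ->
  forall t, t \in `[0, tf] ->
  ((sqn (Sop tf sys Sig Q W u t - feedthrough *m u t))%:E <= c%:E * energy tf u)%E.
Proof.
have [kap kb] := impulse_bounded sys tf.
have mk i j := measurable_impulse sys i j.
have [C GC] := Gop_op; have C0 := op_ge0 GC.
have k0 := kap_ge0 tf0 kb.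
pose c1 := sqfrob N0 * (tf * kap * (sqfrob (Sig *m Q) * C)).
pose c2 := sqfrob (N0 *m (D *m (Sig *m Q))) * (tf * kap).
have c10 : 0 <= c1 by rewrite !mulr_ge0 ?sqfrob_ge0 // ltW.
have c20 : 0 <= c2 by rewrite !mulr_ge0 ?sqfrob_ge0 // ltW.
exists (2 * c1 + 2 * c2); first by lra.
move=> u Hu t tI.
have rI : tf - t \in `[0, tf] by move: tI; rewrite !in_itv /=; lra.
pose z := mxop (Sig *m Q) (revop tf (Gop sys u)).
have Hz : L2sig tf z.
  by apply: L2sig_mxop; apply: L2sig_revop; exact: (op_L2 GC Hu).
have -> : Sop tf sys Sig Q W u t - feedthrough *m u t =
    N0 *m volterra k z (tf - t) + (N0 *m (D *m (Sig *m Q))) *m volterra k u t.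
  have -> : Sop tf sys Sig Q W u t = N0 *m (volterra k z (tf - t) + D *m z (tf - t)) by [].
  have -> : z (tf - t) = (Sig *m Q) *m (volterra k u t + D *m u t).
    by rewrite /z /mxop /revop opprB addrC subrK GopE.
  rewrite /feedthrough !mulmxDr -!mulmxA -addrA; congr (_ + _).
  by rewrite addrK.
have nu := energy_fin_num Hu.
apply: (@le_trans _ _ (2 * sqn (N0 *m volterra k z (tf - t)) +
   2 * sqn ((N0 *m (D *m (Sig *m Q))) *m volterra k u t))%:E).
  by rewrite lee_fin; have := sqnD_le (N0 *m volterra k z (tf - t))
   ((N0 *m (D *m (Sig *m Q))) *m volterra k u t) (@ltr01 R); rewrite invr1.
rewrite -(fineK nu) -EFinM lee_fin; set x := fine (energy tf u).
have -> : (2 * c1 + 2 * c2) * x = 2 * (c1 * x) + 2 * (c2 * x) by ring.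
apply: lerD; rewrite ler_pM2l //.
  apply: le_trans (sqn_mulmx _ _) _; rewrite /c1 -mulrA ler_wpM2l ?sqfrob_ge0 //.
  have := sqn_volterra_le tf0 mk kb rI Hz; rewrite -(fineK (energy_fin_num Hz)) -EFinM lee_fin.
  move=> /le_trans; apply; rewrite -mulrA ler_wpM2l //.
    by rewrite mulr_ge0 // ltW.
  rewrite -lee_fin EFinM !fineK ?energy_fin_num //.
  have Hr : L2sig tf (revop tf (Gop sys u)).
    by apply: L2sig_revop; exact: (op_L2 GC Hu).
  have [mr _] := (L2sigP _ _).1 Hr.
  apply: le_trans (energy_mxop _ mr) _.
  have [mg _] := (L2sigP _ _).1 (op_L2 GC Hu).
  rewrite energy_revop // EFinM -muleA lee_wpmul2l ?lee_fin ?sqfrob_ge0 //.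
  exact: (op_energy GC).
apply: le_trans (sqn_mulmx _ _) _; rewrite /c2 -mulrA ler_wpM2l ?sqfrob_ge0 //.
by have := sqn_volterra_le tf0 mk kb tI Hu; rewrite -(fineK nu) -EFinM lee_fin.
Qed.

Hypothesis sys_sym : externally_symmetric sys Sig.
Hypothesis Q_psd : psdmx Q.
Hypothesis W_pd : pdmx W.

(** By the adjoint formula, W S u = - G* Q G u, so the integral is that of
    - (G u)' Q (G u). *)
Lemma Sop_passive u : L2sig tf u ->
  (\int[mu]_(t in `[0%R, tf]) (dotv (u t) (W *m Sop tf sys Sig Q W u t))%:E <= 0)%E.
Proof.
move=> Hu.
have [kap kb] := impulse_bounded sys tf.
have mk i j := measurable_impulse sys i j.
have [C GC] := Gop_op.
have [SigT SS] := signature_mxP sys_sym.1.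
pose g := Gop sys u; have Hg : L2sig tf g by exact: (op_L2 GC Hu).
pose z := mxop (Sig *m Q) g; have Hz : L2sig tf z by exact: L2sig_mxop.
pose q := mxop Q g; have Hq : L2sig tf q by exact: L2sig_mxop.
have Sz t : Sig *m z t = q t by rewrite /z /q /mxop !mulmxA SS mul1mx.
have Hv : L2sig tf (volterra k u) by exact: (L2sig_volterra tf0 mk kb).
pose vr := mxop Sig (revop tf (volterra k (revop tf z))).
have Hvr : L2sig tf vr.
  apply: L2sig_mxop; apply: L2sig_revop; apply: (L2sig_volterra tf0 mk kb).
  exact: L2sig_revop.
pose Dq := mxop D^T q; have HDq : L2sig tf Dq by exact: L2sig_mxop.
have WS t : t \in `[0, tf] -> W *m Sop tf sys Sig Q W u t = - (vr t + Dq t).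
  move=> tI; have -> : Sop tf sys Sig Q W u t =
     N0 *m (volterra k (revop tf z) (tf - t) + D *m revop tf z (tf - t)) by [].
  rewrite mulmxA mulmxN mulmxA mulmxV ?pdmx_unit // mul1mx mulNmx.
  congr (- _); rewrite mulmxDr; congr (_ + _).
  rewrite /Dq /mxop -Sz mulmxA -sysD_sym // -mulmxA /revop opprB addrC subrK.
  by [].
have -> : (\int[mu]_(t in `[0%R, tf]) (dotv (u t) (W *m Sop tf sys Sig Q W u t))%:E =
  \int[mu]_(t in `[0%R, tf]) (- ((dotv (u t) (vr t))%:E + (dotv (u t) (Dq t))%:E)))%E.
  apply: eq_integral => t; rewrite inE => tI; rewrite WS // -EFinD -EFinN; congr EFin.
  by rewrite !dotvE mulmxN mulmxDr !mxE.
have i1 := integrable_dotv Hu Hvr; have i2 := integrable_dotv Hu HDq.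
rewrite integralN /=; last first.
  apply: integrable_add_def => //; exact: integrableD.
rewrite integralD //.
have -> : (\int[mu]_(t in `[0%R, tf]) (dotv (u t) (vr t))%:E =
    \int[mu]_(t in `[0%R, tf]) (dotv (volterra k u t) (q t))%:E)%E.
  have Hsym t : t \in `[0, tf] -> Sig *m k t = (k t)^T *m Sig.
    by move=> _; exact: impulse_sym.
  have := volterra_adjoint tf0 mk kb Hsym Hu Hz.
  by under [in RHS]eq_integral do rewrite Sz.
have i3 := integrable_dotv Hv Hq.
rewrite -integralD //.
rewrite oppe_le0; apply: integral_ge0 => t tI.
rewrite -EFinD lee_fin.
have -> : dotv (u t) (Dq t) = dotv (D *m u t) (q t) by rewrite dotv_mulmxl.
have -> : dotv (volterra k u t) (q t) + dotv (D *m u t) (q t) = dotv (g t) (q t).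
  by rewrite !dotvE -[g t]/(volterra k u t + D *m u t) linearD mulmxDl [RHS]mxE.
rewrite dotvE /q /mxop mulmxA; exact: Q_psd.2.
Qed.

Variable alpha : R.
Hypothesis alpha_gt0 : 0 < alpha.
Hypothesis alpha_lt : alpha < Num.min (alpha_bar tf sys Sig Q W) 1.

Notation Y := (sqrtmx W).
Notation S := (Sop tf sys Sig Q W).

(** The linear part of the relaxed iteration, which propagates the error. *)
Definition relaxed (u : signal R m) : signal R m :=
  (fun t => (1 - alpha) *: u t) \+ (fun t => alpha *: S u t).

Lemma relaxed_op : exists C, signal_op P tf relaxed C.
Proof.
have [C SC] := Sop_op.
eexists; apply: signal_op_add => //; first exact: signal_op_scale.
exact: (signal_op_comp (signal_op_scale P tf m alpha) SC).
Qed.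

Lemma sqrtmx_unit : Y \in unitmx.
Proof.
have [_ YY] := sqrtmxP (pdmx_psdmx W_pd).
have : Y *m Y \in unitmx by rewrite YY pdmx_unit.
by rewrite unitmx_mul => /andP[].
Qed.

Lemma Sop_energy_le u : L2sig tf u ->
  (energy tf (mxop Y (S u)) <=
   (opnorm tf (mxop Y \o S \o mxop (invmx Y)) ^+ 2)%:E * energy tf (mxop Y u))%E.
Proof.
move=> Hu; have [C SC] := Sop_op.
have FC := signal_op_comp (signal_op_mxop P tf Y)
   (signal_op_comp SC (signal_op_mxop P tf (invmx Y))).
have := opnormP (op_L2 FC) (opZ FC) (op_energy FC) (L2sig_mxop Y Hu).
have Yu := sqrtmx_unit.
have -> : mxop (invmx Y) (mxop Y u) = u.
  by apply/funext => t; rewrite /mxop mulmxA mulVmx // mul1mx.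
exact.
Qed.

(** In the expansion of the energy of Y ((1 - alpha) u + alpha S u) the mixed term is
    nonpositive by passivity and alpha <= 1.  The factor is therefore
    rho = (1 - alpha)^2 + alpha^2 N^2, and
    1 - rho = alpha (2 - alpha (N^2 + 1)). *)
Lemma relaxed_contraction : exists2 rho, 0 <= rho < 1 & forall u, L2sig tf u ->
  (energy tf (mxop Y (relaxed u)) <= rho%:E * energy tf (mxop Y u))%E.
Proof.
set Nn := opnorm tf (mxop Y \o S \o mxop (invmx Y)).
have [YT YY] := sqrtmxP (pdmx_psdmx W_pd).
have Nn2 : 0 <= Nn ^+ 2 by rewrite sqr_ge0.
move: alpha_lt; rewrite lt_min => /andP[]; rewrite /alpha_bar -/Nn => aN a1.
have p1 : 0 < Nn ^+ 2 + 1 by apply: ltr_wpDl.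
have aN' : alpha * (Nn ^+ 2 + 1) < 2 by rewrite -ltr_pdivlMr.
exists ((1 - alpha) ^+ 2 + alpha ^+ 2 * Nn ^+ 2).
  apply/andP; split; first by rewrite addr_ge0 ?sqr_ge0 // mulr_ge0 ?sqr_ge0.
  rewrite -subr_gt0.
  have -> : 1 - ((1 - alpha) ^+ 2 + alpha ^+ 2 * Nn ^+ 2) =
    alpha * (2 - alpha * (Nn ^+ 2 + 1)) by ring.
  by rewrite mulr_gt0 // subr_gt0.
move=> u Hu; have [C SC] := Sop_op; have HS : L2sig tf (S u) by exact: (op_L2 SC).
have HYu : L2sig tf (mxop Y u) by exact: L2sig_mxop.
have HYS : L2sig tf (mxop Y (S u)) by exact: L2sig_mxop.
have HWS : L2sig tf (mxop W (S u)) by exact: L2sig_mxop.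
have [mYu nYu] := (L2sigP _ _).1 HYu; have [mYS nYS] := (L2sigP _ _).1 HYS.
have id0 := integrable_dotv Hu HWS.
set I := (\int[mu]_(t in `[0%R, tf]) (dotv (u t) (W *m S u t))%:E)%E.
have I0 : (I <= 0)%E by exact: Sop_passive.
have If : I \is a fin_num by exact: integrable_fin_num.
have sqn_integrable (v : signal R m) : L2sig tf v ->
    mu.-integrable `[0, tf] (fun t => (sqn (v t))%:E).
  have -> : (fun t => (sqn (v t))%:E) = (fun t => (dotv (v t) (v t))%:E).
    by apply/funext => t; rewrite sqnE.
  by move=> Hv; exact: integrable_dotv.
have iY := sqn_integrable _ HYu; have iYS := sqn_integrable _ HYS.
have -> : (energy tf (mxop Y (relaxed u)) =
   ((1 - alpha) ^+ 2)%:E * energy tf (mxop Y u) + (2 * alpha * (1 - alpha))%:E * I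
   + (alpha ^+ 2)%:E * energy tf (mxop Y (S u)))%E.
  have mI : measurable (`[0, tf]%classic : set (measurableTypeR R)) by exact: measurable_itv.
  have j1 := integrableZl mI ((1 - alpha) ^+ 2) iY.
  have j2 := integrableZl mI (2 * alpha * (1 - alpha)) id0.
  have j3 := integrableZl mI (alpha ^+ 2) iYS.
  have j12 := integrableD mI j1 j2.
  rewrite /energy /I -!integralZl // -!integralD //.
  apply: eq_integral => t _; rewrite -!EFinM -!EFinD; congr EFin.
  have -> : mxop Y (relaxed u) t = (1 - alpha) *: (Y *m u t) + alpha *: (Y *m S u t).
    by rewrite /mxop /relaxed /= mulmxDr !scalemxAr.
  have -> : dotv (u t) (W *m S u t) = dotv (Y *m u t) (Y *m S u t).
    by rewrite dotv_mulmxl YT.1 mulmxA YY.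
  rewrite sqnD !sqnZ dotvZ /mxop; ring.
have SN := Sop_energy_le Hu.
move: SN I0; rewrite -/Nn -(fineK If) -(fineK (energy_fin_num HYS)) -(fineK (energy_fin_num HYu)).
rewrite -!EFinM -!EFinD !lee_fin => SN I0.
set x := fine (energy tf (mxop Y u)) in SN *; set y := fine (energy tf (mxop Y (S u))) in SN *.
set i := fine I in I0 *.
have a2 : 0 <= alpha ^+ 2 by rewrite sqr_ge0.
have : alpha ^+ 2 * y <= alpha ^+ 2 * (Nn ^+ 2 * x) by rewrite ler_wpM2l.
have : 2 * alpha * (1 - alpha) * i <= 0.
  apply: mulr_ge0_le0 => //; apply: mulr_ge0; last by lra.
  by apply: mulr_ge0 => //; exact: ltW.
rewrite mulrDl -mulrA; lra.
Qed.

Lemma relaxed_pointwise : exists2 rho, 0 <= rho < 1 & exists2 c, 0 <= c &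
  exists K0 : 'M[R]_m,
  [/\ forall u, L2sig tf u ->
        (energy tf (mxop Y (relaxed u)) <= rho%:E * energy tf (mxop Y u))%E,
      forall v, sqn (Y *m (K0 *m v)) <= rho * sqn (Y *m v)
    & forall u, L2sig tf u -> forall t, t \in `[0, tf] ->
        ((sqn (relaxed u t - K0 *m u t))%:E <= c%:E * energy tf u)%E].
Proof.
have [rho rho01 Hrho] := relaxed_contraction.
have [c c0 Hc] := Sop_split.
have [C KC] := relaxed_op.
exists rho => //; exists (alpha ^+ 2 * c); first by rewrite mulr_ge0 ?sqr_ge0.
pose K0 := (1 - alpha)%:M + alpha *: feedthrough.
exists K0.
have Hpt u : L2sig tf u -> forall t, t \in `[0, tf] ->
    ((sqn (relaxed u t - K0 *m u t))%:E <= (alpha ^+ 2 * c)%:E * energy tf u)%E.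
  move=> Hu t tI.
  have -> : relaxed u t - K0 *m u t = alpha *: (S u t - feedthrough *m u t).
    rewrite /relaxed /K0 /= mulmxDl mul_scalar_mx -scalemxAl scalerBr.
    by rewrite opprD addrACA subrr add0r.
  rewrite sqnZ (EFinM (alpha ^+ 2)) (EFinM (alpha ^+ 2) c) -muleA.
  rewrite lee_wpmul2l ?lee_fin ?sqr_ge0 //.
  exact: Hc.
split=> //; move/andP: rho01 => [rho0 _].
apply: (contraction_instantaneous_part tf0 _ rho0 (op_L2 KC) Hpt Hrho).
by rewrite mulr_ge0 ?sqr_ge0.
Qed.

End Iteration.

(** * Second moments and covariance matrices *)

Section Moments.
Context d (T : measurableType d) (R : realType) (P : probability T R).
Variables (tf : R) (m : nat).
Hypothesis tf0 : 0 < tf.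

Lemma enorm_le_sqfrob p (M : 'M[R]_(m, p)) v : enorm v <= 1 ->
  enorm (M *m v) <= Num.sqrt (sqfrob M).
Proof.
move=> v1; apply: ler_wsqrtr; apply: le_trans (sqn_mulmx M v) _.
rewrite ler_piMr ?sqfrob_ge0 // -enorm_sqr expr_le1 //.
by rewrite sqrtr_ge0.
Qed.

Lemma mxnorm2_le p (M : 'M[R]_(m, p)) : mxnorm2 M <= Num.sqrt (sqfrob M).
Proof.
apply: ge_sup; last by move=> _ [v v1 <-]; exact: enorm_le_sqfrob.
exists (enorm (M *m 0)); exists 0 => //=.
by rewrite -(ler_pXn2r (ltn0Sn 1)) ?nnegrE ?sqrtr_ge0 // enorm_sqr sqn0 expr1n.
Qed.

(** Test the norm on a unit vector. *)
Lemma diag_le_mxnorm2 (M : 'M[R]_m) i : M i i <= mxnorm2 M.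
Proof.
pose e : 'cV[R]_m := delta_mx i 0.
have e1 : enorm e <= 1.
  rewrite -(ler_pXn2r (ltn0Sn 1)) ?nnegrE ?sqrtr_ge0 // enorm_sqr expr1n.
  rewrite /sqn (bigD1 i) //= big1 ?addr0.
    by rewrite mxE !eqxx expr1n.
  by move=> j ji; rewrite mxE (negbTE ji) expr0n.
apply: (@le_trans _ _ (enorm (M *m e))); last first.
  apply: ub_le_sup; last by exists e.
  by exists (Num.sqrt (sqfrob M)) => _ [v v1 <-]; exact: enorm_le_sqfrob.
have Me : (M *m e) i 0 = M i i by rewrite -colE mxE.
apply: le_trans (ler_norm _) _.
rewrite -(ler_pXn2r (ltn0Sn 1)) ?nnegrE ?sqrtr_ge0 // enorm_sqr real_normK ?num_real //.
by rewrite -Me; exact: sqr_le_sqn.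
Qed.

Lemma sq_integrable_Lfun (f : T -> R) : sq_integrable P setT f -> f \in Lfun P 2%:E.
Proof.
move=> [mf foo]; rewrite inE; apply/andP; split; rewrite inE //=.
rewrite /finite_norm unlock /Lnorm poweR_lty //.
apply: le_lt_trans foo; rewrite le_eqVlt; apply/orP; left; apply/eqP.
apply: eq_integral => w _ /=.
by rewrite powR_mulrn // real_normK ?num_real.
Qed.

Lemma Lfun_sq_integrable (f : T -> R) : f \in Lfun P 2%:E -> sq_integrable P setT f.
Proof.
move=> Hf; have /integrableP[_] := Lfun2_integrable_sqr Hf => foo; split.
  by move: Hf; rewrite inE => /andP[]; rewrite inE.
apply: le_lt_trans foo; rewrite le_eqVlt; apply/orP; left; apply/eqP.
by apply: eq_integral => w _; rewrite /= ger0_norm ?sqr_ge0.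
Qed.

(** The noise has zero mean, so its second moment is the trace of its covariance
    matrix; each of the m diagonal entries is at most the spectral norm. *)
Lemma noise_moment sigma (X : T -> signal R m) t : t \in `[0, tf] ->
  measurement_noise P tf sigma X ->
  (\int[P]_w (sqn (X w t))%:E <= (m%:R * sigma ^+ 2)%:E)%E.
Proof.
move=> tI [mX _ X0 Xv]; have [XL XC] := Xv t tI.
have sqX i := Lfun_sq_integrable (XL i).
rewrite /sqn; under eq_integral do rewrite -sumEFin.
rewrite ge0_integral_sum //; last 2 first.
- move=> i; apply/measurable_EFinP; apply: measurable_funX; exact: (sqX i).1.
- by move=> i w _; rewrite lee_fin sqr_ge0.
have -> : (m%:R * sigma ^+ 2)%:E = (\sum_(i < m) (sigma ^+ 2)%:E)%E.
  by rewrite sumEFin sumr_const card_ord mulr_natl.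
apply: lee_sum => i _.
have : Cov P X t i i <= sigma ^+ 2 by apply: le_trans XC; exact: diag_le_mxnorm2.
rewrite mxE unlock expectationE.
have fin : (\int[P]_w (X w t i 0 ^+ 2)%:E)%E \is a fin_num.
  by apply: integrable_fin_num => //; exact: sq_integrable_sqr.
rewrite -[X in (X <= _)%E](fineK fin) lee_fin.
have E0 := X0 t tI i.
congr (_ <= _); congr fine; apply: eq_integral => w _.
rewrite E0; congr EFin.
by rewrite -[LHS]/((X w t i 0 - 0) * (X w t i 0 - 0)) !subr0 expr2.
Qed.

(** A deterministic shift does not change the covariance; for the centered part
    every entry is bounded by means of 2 |a b| <= a^2 + b^2, and the spectral norm
    by the Frobenius norm. *)
Lemma centered_covariance (X V : T -> signal R m) (u : signal R m) c t :
  t \in `[0, tf] -> measurable_process tf V -> zero_mean P tf V ->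
  (\int[P]_w (sqn (V w t))%:E <= c%:E)%E ->
  (forall w, X w t = u t + V w t) ->
  (forall i, (fun w => X w t i 0) \in Lfun P 2%:E) /\
  mxnorm2 (Cov P X t) <= Num.sqrt (\sum_(i < m) \sum_(j < m) (2 * c) ^+ 2).
Proof.
move=> tI mV V0 Vc XV.
have sqV i := @entry_sq_integrable _ T R P tf m V mV c t i tI Vc.
have iV i := @entry_integrable _ T R P tf m V mV c t i tI Vc.
have P1 : (P setT < +oo)%E by apply: le_lt_trans (probability_le1 _ _) _; rewrite ?ltry.
have XE i : (fun w => X w t i 0) = (fun w => u t i 0 + V w t i 0).
  by apply/funext => w; rewrite XV mxE.
have sqX i : sq_integrable P setT (fun w => X w t i 0).
  rewrite XE; apply: sq_integrableD => //; split=> //.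
  by rewrite integral_cst // lte_mul_pinfty ?lee_fin ?sqr_ge0.
split; first by move=> i; exact: sq_integrable_Lfun.
apply: le_trans (mxnorm2_le _) _; apply: ler_wsqrtr.
have EX i : ('E_P[fun w => X w t i 0%R] = (u t i 0)%:E)%E.
  rewrite XE expectationE; under eq_integral do rewrite EFinD.
  rewrite integralD //; [|exact: (integrable_const measurableT _ P1)|exact: iV].
  rewrite integral_cst // -[X in (_ + X)%E]expectationE V0 // adde0.
  by rewrite -[RHS]mule1; congr (_ * _)%E; exact: probability_setT.
have c0 : 0 <= c.
  rewrite -lee_fin; apply: le_trans Vc.
  by apply: integral_ge0 => w _; rewrite lee_fin sqn_ge0.
apply: ler_sum => i _; apply: ler_sum => j _; rewrite mxE unlock !EX expectationE /=.
set I := (\int[P]_w _)%E.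
have IE : I = (\int[P]_w (V w t i 0 * V w t j 0)%:E)%E.
  apply: eq_integral => w _; congr EFin.
  rewrite -[LHS]/((X w t i 0 - u t i 0) * (X w t j 0 - u t j 0)).
  by rewrite XV !mxE ![u t _ _ + _]addrC !addrK.
have iVV : P.-integrable setT (EFin \o (fun w => V w t i 0 * V w t j 0)).
  exact: sq_integrableM.
have If : I \is a fin_num by rewrite IE; exact: integrable_fin_num.
rewrite -(real_normK (num_real _)) lerXn2r ?nnegrE //; first by lra.
have H (r : R) : (r%:E = I)%E -> `|r| <= 2 * c.
  move=> rI; rewrite -lee_fin -abse_EFin rI IE.
  have iVV' := iVV.
  apply: (le_trans (le_abse_integral P measurableT (measurable_int P iVV'))).
  apply: (@le_trans _ _ (\int[P]_w (2%:E * (sqn (V w t))%:E))%E).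
    apply: ge0_le_integral => //.
    - by apply: measurableT_comp => //; exact: (measurable_int P iVV').
    - by apply: measurable_funeM; exact: measurable_sqn_at.
    - move=> w _ /=; rewrite -EFinM lee_fin normrM.
      have := sqr_le_sqn (V w t) i; have := sqr_le_sqn (V w t) j.
      rewrite -(real_normK (num_real (V w t i 0))) -(real_normK (num_real (V w t j 0))).
      have := sqr_ge0 (`|V w t i 0| - `|V w t j 0|); nra.
  rewrite ge0_integralZl //; last 2 first.
  - exact: measurable_sqn_at.
  - by move=> w _; rewrite lee_fin sqn_ge0.
  by rewrite EFinM lee_wpmul2l.
by apply: H; rewrite fineK.
Qed.

End Moments.

(** * Uniform second moments of a noisy contraction *)

Section UniformMoment.
Context d (T : measurableType d) (R : realType) (P : probability T R).
Variables (tf : R) (m : nat).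
Hypothesis tf0 : 0 < tf.
Variables (F : signal R m -> signal R m) (C : R) (K0 Y : 'M[R]_m) (rho c cz : R).
Hypothesis F_op : signal_op P tf F C.
Hypothesis Y_unit : Y \in unitmx.
Hypothesis rho01 : 0 <= rho < 1.
Hypothesis c0 : 0 <= c.
Hypothesis F_contr : forall u, L2sig tf u ->
  (energy tf (mxop Y (F u)) <= rho%:E * energy tf (mxop Y u))%E.
Hypothesis K0_contr : forall v, sqn (Y *m (K0 *m v)) <= rho * sqn (Y *m v).
Hypothesis F_split : forall u, L2sig tf u -> forall t, t \in `[0, tf] ->
  ((sqn (F u t - K0 *m u t))%:E <= c%:E * energy tf u)%E.
Variables (N Z : nat -> T -> signal R m).
Hypothesis N0 : forall w t, t \in `[0, tf] -> N 0%N w t = 0.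
Hypothesis N_rec : forall k w t, t \in `[0, tf] ->
  N k.+1 w t = F (N k w) t + Z k w t.
Hypothesis N_so : forall k, exists cn, second_order P tf cn (N k).
Hypothesis Z_so : forall k, second_order P tf cz (Z k).

(* This makes 1 - r = (1 - rho) (2 - rho) / 2 > 0. *)
Let dl : R := (1 - rho) / 2.
Let r : R := (1 + dl) * rho.

Let dl_gt0 : 0 < dl. Proof. by move: rho01 => /andP[_ r1]; rewrite /dl; lra. Qed.

Let dl1_ge0 : 0 <= 1 + dl. Proof. by rewrite addr_ge0 // ltW. Qed.

Let r01 : 0 <= r < 1.
Proof.
move: rho01 => /andP[r0 r1].
have p1 : 0 < 1 - rho by lra.
have p2 : 0 < 2 - rho by lra.
have := mulr_gt0 p1 p2; rewrite /r /dl => p3.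
by apply/andP; split; [apply: mulr_ge0 => //; lra|nra].
Qed.

Let dli_ge0 : 0 <= 1 + dl^-1.
Proof. by rewrite addr_ge0 // invr_ge0 ltW. Qed.

Let cz0 : 0 <= cz. Proof. exact: (second_order_ge0 tf0 (Z_so 0)). Qed.

Let C1 : R := (1 + dl^-1) * sqfrob Y.

Let C1_ge0 : 0 <= C1. Proof. by rewrite mulr_ge0 // sqfrob_ge0. Qed.

(* The fixed point of b |-> r b + C1 tf cz. *)
Let B : R := C1 * (tf * cz) / (1 - r).

Let B_ge0 : 0 <= B.
Proof.
rewrite divr_ge0 //; last by move: r01 => /andP[_]; lra.
by rewrite mulr_ge0 // mulr_ge0 // ltW.
Qed.

Let N_L2 k w : L2sig tf (N k w).
Proof. by have [cn []] := N_so k. Qed.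

Let N_meas k : measurable_process tf (N k).
Proof. by have [cn []] := N_so k. Qed.

Let YN_meas k : measurable_process tf (fun w => mxop Y (N k w)).
Proof. exact: measurable_process_mxop. Qed.

Let Z_meas k : measurable_process tf (Z k).
Proof. by have [] := Z_so k. Qed.

(** The path energies contract with factor r up to the noise, so their means stay
    below the fixed point of the affine recursion that they satisfy. *)
Lemma weighted_energy_le k : (\int[P]_w energy tf (mxop Y (N k w)) <= B%:E)%E.
Proof.
elim: k => [|k IH].
  rewrite integral0_eq // => w _; rewrite /energy integral0_eq // => t tI.
  by rewrite /mxop N0 // mulmx0 sqn0.
have step w : (energy tf (mxop Y (N k.+1 w)) <=
    r%:E * energy tf (mxop Y (N k w)) + C1%:E * energy tf (Z k w))%E.
  have LF : L2sig tf (F (N k w)) by exact: (op_L2 F_op).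
  have [mF _] := (L2sigP _ _).1 LF.
  have [_ LZ _ _] := Z_so k; have [mZ _] := (L2sigP _ _).1 (LZ w).
  have mYF := @measurable_sig_mxop R tf m m Y _ mF.
  have mYZ := @measurable_sig_mxop R tf m m Y _ mZ.
  have -> : energy tf (mxop Y (N k.+1 w)) =
      energy tf (mxop Y (F (N k w)) \+ mxop Y (Z k w)).
    by apply: energy_eq => t tI; rewrite /mxop /= N_rec // mulmxDr.
  apply: le_trans (energyD_le dl_gt0 mYF mYZ) _; apply: leeD.
    rewrite /r EFinM -muleA lee_wpmul2l ?lee_fin //.
    exact: F_contr.
  by rewrite /C1 EFinM -muleA lee_wpmul2l ?lee_fin // energy_mxop.
have /andP[r0 r1] := r01.
have mYN := measurable_energy (YN_meas k).
have mZ := measurable_energy (Z_meas k).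
apply: (@le_trans _ _ (\int[P]_w (r%:E * energy tf (mxop Y (N k w)) +
    C1%:E * energy tf (Z k w)))%E).
  apply: ge0_le_integral => //.
  - by move=> w _; exact: energy_ge0.
  - exact: measurable_energy (YN_meas k.+1).
  - by apply: emeasurable_funD; exact: measurable_funeM.
rewrite ge0_integralD //;
  try (by move=> w _; rewrite mule_ge0 ?lee_fin ?energy_ge0);
  try (exact: measurable_funeM).
rewrite !ge0_integralZl //; try (by move=> w _; exact: energy_ge0).
have -> : B = r * B + C1 * (tf * cz).
  rewrite /B; field; move: r1; lra.
rewrite EFinD !(EFinM r) (EFinM C1); apply: leeD; rewrite lee_wpmul2l ?lee_fin //.
by apply: mean_energy_le => //; have [] := Z_so k.
Qed.

Let Bn : R := sqfrob (invmx Y) * B.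

Let mean_energy_N k : (\int[P]_w energy tf (N k w) <= Bn%:E)%E.
Proof.
apply: (@le_trans _ _ (\int[P]_w ((sqfrob (invmx Y))%:E * energy tf (mxop Y (N k w))))%E).
  apply: ge0_le_integral => //.
  - by move=> w _; exact: energy_ge0.
  - exact: measurable_energy (N_meas k).
  - by apply: measurable_funeM; exact: measurable_energy (YN_meas k).
  - move=> w _; have [mN _] := (L2sigP _ _).1 (N_L2 k w).
    have -> : energy tf (N k w) = energy tf (mxop (invmx Y) (mxop Y (N k w))).
      by apply: energy_eq => t _; rewrite /mxop mulmxA mulVmx // mul1mx.
    by apply: energy_mxop; exact: measurable_sig_mxop.
rewrite ge0_integralZl //.
- by rewrite /Bn EFinM lee_wpmul2l ?lee_fin ?sqfrob_ge0 // weighted_energy_le.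
- exact: measurable_energy (YN_meas k).
- by move=> w _; exact: energy_ge0.
- by rewrite lee_fin sqfrob_ge0.
Qed.

Let C2 : R := 2 * C1 * c.
Let C3 : R := 2 * C1.
Let B' : R := (C2 * Bn + C3 * cz) / (1 - r).

(** Split F into its instantaneous part K0, which contracts with factor rho, and a
    remainder that only sees the energy of the whole path. *)
Let sqn_step k w t : t \in `[0, tf] ->
  ((sqn (Y *m N k.+1 w t))%:E <= r%:E * (sqn (Y *m N k w t))%:E +
    (C2%:E * energy tf (N k w) + C3%:E * (sqn (Z k w t))%:E))%E.
Proof.
move=> tI; have NL := N_L2 k w.
have nf := energy_fin_num NL; have := F_split NL tI.
rewrite -(fineK nf) -!EFinM -!EFinD !lee_fin; set x := fine _ => Fx.
have -> : Y *m N k.+1 w t =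
   Y *m (K0 *m N k w t) + Y *m ((F (N k w) t - K0 *m N k w t) + Z k w t).
  by rewrite -mulmxDr N_rec // addrA [K0 *m _ + _]addrC subrK.
apply: le_trans (sqnD_le _ _ dl_gt0) _; apply: lerD.
  by rewrite /r -mulrA ler_wpM2l.
apply: (@le_trans _ _ (C1 * sqn ((F (N k w) t - K0 *m N k w t) + Z k w t))).
  by rewrite /C1 -mulrA ler_wpM2l // sqn_mulmx.
have -> : C2 * x + C3 * sqn (Z k w t) = C1 * (2 * (c * x) + 2 * sqn (Z k w t)).
  by rewrite /C2 /C3; ring.
rewrite ler_wpM2l //.
have := sqnD_le (F (N k w) t - K0 *m N k w t) (Z k w t) (@ltr01 R).
by rewrite invr1; lra.
Qed.

(** An affine recursion again, now at a fixed instant, with the bounded mean energy as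
    part of the forcing term. *)
Lemma mean_sqn_le k t : t \in `[0, tf] ->
  (\int[P]_w (sqn (Y *m N k w t))%:E <= B'%:E)%E.
Proof.
move=> tI; have /andP[r0 r1] := r01.
have Bn0 : 0 <= Bn by rewrite mulr_ge0 // sqfrob_ge0.
have C30 : 0 <= C3 by exact: mulr_ge0.
have C20 : 0 <= C2 by exact: mulr_ge0.
have B'0 : 0 <= B'.
  rewrite divr_ge0 //; last by lra.
  by rewrite addr_ge0 // mulr_ge0.
elim: k => [|k IH].
  by rewrite integral0_eq // => w _; rewrite N0 // mulmx0 sqn0.
have mY l := measurable_sqn_at (YN_meas l) tI.
have mn := measurable_energy (N_meas k).
have mz := measurable_sqn_at (Z_meas k) tI.
apply: (@le_trans _ _ (\int[P]_w (r%:E * (sqn (Y *m N k w t))%:E +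
    (C2%:E * energy tf (N k w) + C3%:E * (sqn (Z k w t))%:E)))%E).
  apply: ge0_le_integral => //.
  - by move=> w _; rewrite lee_fin sqn_ge0.
  - exact: mY.
  - apply: emeasurable_funD; first by apply: measurable_funeM; exact: mY.
    by apply: emeasurable_funD; exact: measurable_funeM.
  - by move=> w _; exact: sqn_step.
have s0 (v : 'cV[R]_m) : (0 <= (sqn v)%:E)%E by rewrite lee_fin sqn_ge0.
rewrite ge0_integralD //;
  try (by move=> w _; rewrite ?adde_ge0 // mule_ge0 ?lee_fin ?sqn_ge0 ?energy_ge0);
  try (by apply: measurable_funeM; exact: mY);
  try (by apply: emeasurable_funD; exact: measurable_funeM).
rewrite ge0_integralD //;
  try (by move=> w _; rewrite mule_ge0 ?lee_fin ?sqn_ge0 ?energy_ge0);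
  try (by apply: measurable_funeM).
rewrite !ge0_integralZl //; try (by move=> w _; rewrite ?energy_ge0 ?s0); try exact: mY.
have -> : B' = r * B' + (C2 * Bn + C3 * cz).
  rewrite /B'; field; move: r1; lra.
have -> : (r * B' + (C2 * Bn + C3 * cz))%:E =
    (r%:E * B'%:E + (C2%:E * Bn%:E + C3%:E * cz%:E))%E by [].
have [_ _ Zc _] := Z_so k.
apply: leeD; first exact: lee_wpmul2l.
apply: leeD; first exact: (lee_wpmul2l _ (mean_energy_N k)).
exact: (lee_wpmul2l _ (Zc t tI)).
Qed.

Lemma uniform_second_moment : exists b, forall k t, t \in `[0, tf] ->
  (\int[P]_w (sqn (N k w t))%:E <= b%:E)%E.
Proof.
exists (sqfrob (invmx Y) * B') => k t tI.
have mY := measurable_sqn_at (YN_meas k) tI.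
apply: (@le_trans _ _ (\int[P]_w ((sqfrob (invmx Y))%:E * (sqn (Y *m N k w t))%:E))%E).
  apply: ge0_le_integral => //.
  - by move=> w _; rewrite lee_fin sqn_ge0.
  - exact: (measurable_sqn_at (N_meas k) tI).
  - by apply: measurable_funeM; exact: mY.
  - move=> w _; rewrite -EFinM lee_fin.
    have -> : N k w t = invmx Y *m (Y *m N k w t) by rewrite mulmxA mulVmx // mul1mx.
    by rewrite [in leRHS]mulmxA [in leRHS]mulmxA mulmxV // mul1mx sqn_mulmx.
rewrite ge0_integralZl //.
- by rewrite EFinM lee_wpmul2l ?lee_fin ?sqfrob_ge0 // mean_sqn_le.
- by move=> w _; rewrite lee_fin sqn_ge0.
- by rewrite lee_fin sqfrob_ge0.
Qed.

End UniformMoment.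

(** * Restriction to an event of full probability *)

Section AlmostSure.
Context d (T : measurableType d) (R : realType) (P : probability T R).
Variables (tf : R) (m : nat).
Hypothesis tf0 : 0 < tf.

Lemma signal_op0 F C (u : signal R m) : signal_op P tf F C ->
  (forall t, t \in `[0, tf] -> u t = 0) -> forall t, t \in `[0, tf] -> F u t = 0.
Proof.
move=> HF u0 t tI.
have L0 : L2sig tf (fun=> 0 : 'cV[R]_m).
  apply: (@L2sig_bounded _ _ tf0 _ _ 0) => [i|s _]; last by rewrite sqn0.
  exact: measurable_cst.
rewrite (op_eq HF (v := fun s => 0 *: (0 : 'cV[R]_m))) ?(opZ HF) ?scale0r //.
Qed.

Lemma second_order0 : second_order P tf 0 (fun _ _ => 0 : 'cV[R]_m).
Proof.
split.
- move=> i; exact: measurable_cst.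
- move=> w; apply: (@L2sig_bounded _ _ tf0 _ _ 0) => [i|s _]; last by rewrite sqn0.
  exact: measurable_cst.
- by move=> t _; rewrite integral0_eq // => w _; rewrite sqn0.
- by move=> t _ i; rewrite expectationE integral0_eq // => w _; rewrite mxE.
Qed.

(** The energy of a jointly measurable process is a random variable, so
    square-integrability of the path is an event. *)
Lemma noise_L2_full (eta : T -> signal R m) : measurable_process tf eta ->
  P [set w | L2sig tf (eta w)] = 1%E ->
  measurable [set w | L2sig tf (eta w)] /\ P (~` [set w | L2sig tf (eta w)]) = 0%E.
Proof.
move=> me P1.
have mA : measurable [set w | L2sig tf (eta w)].
  have -> : [set w | L2sig tf (eta w)] =
      setT `&` [set w | (energy tf (eta w) < (fun=> +oo) w)%E].
    apply/seteqP; split=> w /=.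
      by move=> /L2sigP[].
    move=> [_ nw]; apply/L2sigP; split=> // i.
    exact: (@measurable_process_path _ T R tf m eta w i me).
  by apply: measurable_lte => //; exact: measurable_energy.
split=> //; have := probability_setC P mA; rewrite P1 => ->.
by rewrite subee.
Qed.

Variable A : set T.
Hypothesis mA : measurable A.
Hypothesis PA : P (~` A) = 0%E.

Lemma ae_eq_on_full (f g : T -> \bar R) : (forall w, A w -> f w = g w) ->
  ae_eq P setT f g.
Proof.
move=> fg; exists (~` A); split=> //; first exact: measurableC.
move=> w /= nfg Aw; apply: nfg => _; exact: fg.
Qed.

(** The process set to zero outside A.  This preserves joint measurability,
    second moments and means, and makes all paths square-integrable if those
    over A are. *)
Definition restr (X : T -> signal R m) : T -> signal R m :=
  fun w t => \1_A w *: X w t.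

Lemma restr_in X w : A w -> restr X w = X w.
Proof. by move=> Aw; apply/funext => t; rewrite /restr indicE mem_set // scale1r. Qed.

Lemma restr_out X w : ~ A w -> restr X w = fun=> 0.
Proof. by move=> Aw; apply/funext => t; rewrite /restr indicE memNset // scale0r. Qed.

Lemma measurable_process_restr X : measurable_process tf X ->
  measurable_process tf (restr X).
Proof.
move=> mX i.
have -> : (fun z : T * measurableTypeR R => restr X z.1 z.2 i 0) =
    (fun z => \1_A z.1 * X z.1 z.2 i 0).
  by apply/funext => z; rewrite /restr mxE.
apply: measurable_funM; last exact: mX.
apply: measurable_funTS.
exact: (measurableT_comp (measurable_indic (D := setT) mA) measurable_fst).
Qed.

Lemma second_order_restr c X : measurable_process tf X ->
  (forall w, A w -> L2sig tf (X w)) ->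
  (forall t, t \in `[0, tf] -> (\int[P]_w (sqn (X w t))%:E <= c%:E)%E) ->
  zero_mean P tf X -> second_order P tf c (restr X).
Proof.
move=> mX LX Xc X0; have mr := measurable_process_restr mX; split=> //.
- move=> w; have [Aw|Aw] := pselect (A w); first by rewrite restr_in //; exact: LX.
  rewrite restr_out //; have [_ L _ _] := second_order0; exact: L w.
- move=> t tI; apply: le_trans (Xc t tI); apply: ge0_le_integral => //.
  + by move=> w _; rewrite lee_fin sqn_ge0.
  + exact: (measurable_sqn_at mr tI).
  + exact: (measurable_sqn_at mX tI).
  + move=> w _; rewrite lee_fin /restr sqnZ.
    by rewrite ler_piMl ?sqn_ge0 // indicE; case: (w \in A); rewrite ?expr1n ?expr0n.
- move=> t tI i; rewrite -(X0 t tI i) !expectationE.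
  apply: ae_eq_integral => //.
  + by apply/measurable_EFinP; exact: measurable_process_at mr tI.
  + by apply/measurable_EFinP; exact: measurable_process_at mX tI.
  + by apply: ae_eq_on_full => w Aw; rewrite restr_in.
Qed.

Lemma zero_mean_of_restr X : measurable_process tf X ->
  zero_mean P tf (restr X) -> zero_mean P tf X.
Proof.
move=> mX X0 t tI i; rewrite -(X0 t tI i) !expectationE.
apply: ae_eq_integral => //.
+ by apply/measurable_EFinP; exact: measurable_process_at mX tI.
+ apply/measurable_EFinP; apply: measurable_process_at tI.
  exact: measurable_process_restr.
+ by apply: ae_eq_on_full => w Aw; rewrite restr_in.
Qed.

Lemma moment_of_restr X t : measurable_process tf X -> t \in `[0, tf] ->
  (\int[P]_w (sqn (X w t))%:E = \int[P]_w (sqn (restr X w t))%:E)%E.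
Proof.
move=> mX tI; apply: ae_eq_integral => //.
+ exact: (measurable_sqn_at mX tI).
+ exact: (measurable_sqn_at (measurable_process_restr mX) tI).
+ by apply: ae_eq_on_full => w Aw; rewrite restr_in.
Qed.

End AlmostSure.

(** * Unbiasedness and bounded variance of the noisy iterates *)
Theorem theorem2 (R : realType) (n m : nat) (sys : system R n m)
  (Sig Q W : 'M[R]_m) (tf : R) (x0 : 'cV[R]_n)
  (d : measure_display) (Omega : measurableType d) (P : probability Omega R)
  (sigma : R) (eta1 eta2 : nat -> Omega -> signal R m)
  (alpha : R)
  (u : nat -> signal R m) (ut nu : nat -> Omega -> signal R m)
  (sys_sym : externally_symmetric sys Sig)
  (Q_psd : psdmx Q) (W_pd : pdmx W) (tf_gt0 : 0 < tf)
  (eta1_noise : forall k, measurement_noise P tf sigma (eta1 k))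
  (eta2_noise : forall k, measurement_noise P tf sigma (eta2 k))
  (eta_indep : forall k, independent_processes P tf (eta1 k) (eta2 k))
  (alpha_gt0 : 0 < alpha)
  (alpha_lt : alpha < Num.min (alpha_bar tf sys Sig Q W) 1)
  (u0_L2 : L2sig tf (u 0%N))
  (u_rec : forall k t, t \in `[0, tf] ->
    u k.+1 t = (1 - alpha) *: u k t
               + alpha *: Top tf sys Sig Q W x0 (u k) t)
  (ut_rec : forall k w t, t \in `[0, tf] ->
    ut k.+1 w t = (1 - alpha) *: ut k w t
      + alpha *: Top_noisy tf sys Sig Q W x0 (eta1 k w) (eta2 k w) (ut k w) t)
  (ut_def : forall k w t, t \in `[0, tf] -> ut k w t = u k t + nu k w t)
  (nu0 : forall w t, t \in `[0, tf] -> nu 0%N w t = 0) :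
  (forall k, zero_mean P tf (nu k)) /\
  (exists c : R, forall k, bounded_variance P tf (ut k) c).
Proof.
have [CG GO] := Gop_op P sys tf_gt0.
have [CH HO] := adjoint_step_op P sys Sig Q W tf_gt0.
have [CK KO] := relaxed_op P sys Sig Q W tf_gt0 alpha.
pose N0 : 'M[R]_m := - (invmx W *m Sig).
pose JN := fun z : signal R m => mxop N0 (revop tf z).
have JO : signal_op P tf JN (sqfrob N0 * 1).
  exact: signal_op_comp (signal_op_mxop P tf N0) (signal_op_revop P tf m).
pose fr := free_response sys x0.
have frL : L2sig tf fr by exact: L2sig_free_response.
have [frm _] := (L2sigP _ _).1 frL.
have mcst (v : signal R m) : L2sig tf v ->
    measurable_process tf (fun _ : Omega => v).
  by move=> /L2sigP[mv _]; exact: measurable_process_cst.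
have uL k : L2sig tf (u k).
  elim: k => [|k IH]; first exact: u0_L2.
  apply: (@L2sig_eq _ _ _ ((fun t => (1 - alpha) *: u k t) \+
     (fun t => alpha *: adjoint_step sys Sig Q W tf (Gop sys (u k) \+ fr) t))).
    by move=> t tI /=; rewrite u_rec.
  exact: (L2sigD (L2sigZ _ IH) (L2sigZ _ (op_L2 HO (L2sigD (op_L2 GO IH) frL)))).
have eta1m k : measurable_process tf (eta1 k) by have [] := eta1_noise k.
have eta2m k : measurable_process tf (eta2 k) by have [] := eta2_noise k.
(* For all outcomes, also those with paths that are not square-integrable. *)
have utm k : measurable_process tf (ut k).
  elim: k => [|k IH].
    apply: measurable_process_eq (mcst _ u0_L2) => w t tI.
    by rewrite ut_def // nu0 // addr0.
  apply: (@measurable_process_eq _ _ _ _ _ (fun w =>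
    (fun t => (1 - alpha) *: ut k w t) \+ (fun t => alpha *:
      (adjoint_step sys Sig Q W tf (Gop sys (ut k w) \+ fr \+ eta1 k w) \+ JN (eta2 k w)) t))).
    move=> w t tI /=; rewrite ut_rec //; congr (_ + _ *: _).
    by rewrite /Top_noisy /mxop /revop mulmxDr.
  apply: measurable_process_add; apply: measurable_process_scale => //.
  apply: measurable_process_add; last exact: (op_meas JO).
  apply: (op_meas HO); apply: measurable_process_add => //.
  apply: measurable_process_add; first exact: (op_meas GO).
  exact: mcst.
have num k : measurable_process tf (nu k).
  apply: (@measurable_process_eq _ _ _ _ _ (fun w =>
    ut k w \+ (fun t => -1 *: u k t))).
    by move=> w t tI /=; rewrite ut_def // scaleN1r addrC addKr.
  apply: measurable_process_add => //.
  by apply: mcst; exact: L2sigZ.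
(* The event on which all noise paths are square-integrable; all iterates are
   square-integrable there. *)
pose A := \bigcap_k ([set w | L2sig tf (eta1 k w)] `&` [set w | L2sig tf (eta2 k w)]).
have full1 k : measurable [set w | L2sig tf (eta1 k w)] /\
    P (~` [set w | L2sig tf (eta1 k w)]) = 0%E.
  by apply: noise_L2_full => //; have [] := eta1_noise k.
have full2 k : measurable [set w | L2sig tf (eta2 k w)] /\
    P (~` [set w | L2sig tf (eta2 k w)]) = 0%E.
  by apply: noise_L2_full => //; have [] := eta2_noise k.
have mA : measurable A.
  apply: bigcapT_measurable => k; apply: measurableI; first exact: (full1 k).1.
  exact: (full2 k).1.
have PA : P (~` A) = 0%E.
  apply/negligibleP; first exact: measurableC.
  rewrite /A setC_bigcap; apply: negligible_bigcup => k; rewrite setCI.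
  apply: negligibleU; apply/negligibleP.
  - by apply: measurableC; exact: (full1 k).1.
  - exact: (full1 k).2.
  - by apply: measurableC; exact: (full2 k).1.
  - exact: (full2 k).2.
have utL w k : A w -> L2sig tf (ut k w).
  move=> Aw; elim: k => [|k IH].
    by apply: L2sig_eq u0_L2 => t tI; rewrite ut_def // nu0 // addr0.
  have [e1 e2] := Aw k Logic.I.
  apply: (@L2sig_eq _ _ _ ((fun t => (1 - alpha) *: ut k w t) \+ (fun t => alpha *:
      (adjoint_step sys Sig Q W tf (Gop sys (ut k w) \+ fr \+ eta1 k w) \+ JN (eta2 k w)) t))).
    move=> t tI /=; rewrite ut_rec //; congr (_ + _ *: _).
    by rewrite /Top_noisy /mxop /revop mulmxDr.
  exact: (L2sigD (L2sigZ _ IH) (L2sigZ _ (L2sigD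
    (op_L2 HO (L2sigD (L2sigD (op_L2 GO IH) frL) e1)) (op_L2 JO e2)))).
have nuL w k : A w -> L2sig tf (nu k w).
  move=> Aw; apply: (@L2sig_eq _ _ _ (ut k w \+ (fun t => -1 *: u k t))).
    by move=> t tI /=; rewrite ut_def // scaleN1r addrC addKr.
  by apply: L2sigD; [exact: utL|exact: L2sigZ].
pose zeta k w := adjoint_step sys Sig Q W tf (restr A (eta1 k) w) \+ JN (restr A (eta2 k) w).
pose N k := restr A (nu k).
(* On A this is the difference of the two iterations, by linearity; outside A
   all terms vanish. *)
have N_rec k w t : t \in `[0, tf] ->
    N k.+1 w t = relaxed sys Sig Q W tf alpha (N k w) t + (alpha *: zeta k w t).
  move=> tI; have [Aw|Aw] := pselect (A w); last first.
    rewrite /N /zeta /= !restr_out // (signal_op0 tf_gt0 KO) //.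
    rewrite (signal_op0 tf_gt0 HO) // (signal_op0 tf_gt0 JO) //.
    by rewrite !addr0 scaler0 addr0.
  rewrite /N /zeta /= !restr_in //.
  have [e1L e2L] := Aw k Logic.I.
  have GL v : L2sig tf v -> L2sig tf (Gop sys v) by exact: (op_L2 GO).
  have HE : adjoint_step sys Sig Q W tf (Gop sys (ut k w) \+ fr \+ eta1 k w) t =
     adjoint_step sys Sig Q W tf (Gop sys (u k) \+ fr) t +
     (adjoint_step sys Sig Q W tf (Gop sys (nu k w)) t + adjoint_step sys Sig Q W tf (eta1 k w) t).
    have g1 := GL _ (uL k); have g2 := GL _ (nuL w k Aw).
    rewrite -(opD HO g2 e1L tI) -(opD HO (L2sigD g1 frL) (L2sigD g2 e1L) tI).
    apply: (op_eq HO) tI => s sI /=.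
    have -> : Gop sys (ut k w) s = Gop sys (u k) s + Gop sys (nu k w) s.
      rewrite -(opD GO (uL k) (nuL w k Aw) sI).
      by apply: (op_eq GO) sI => x xI; rewrite ut_def.
    by rewrite (addrAC (Gop sys (u k) s)) -[LHS]addrA.
  have -> : nu k.+1 w t = ut k.+1 w t - u k.+1 t by rewrite ut_def // addrC addKr.
  rewrite ut_rec // u_rec // ut_def //.
  have -> : Top_noisy tf sys Sig Q W x0 (eta1 k w) (eta2 k w) (ut k w) t =
     adjoint_step sys Sig Q W tf (Gop sys (ut k w) \+ fr \+ eta1 k w) t + JN (eta2 k w) t.
    by rewrite /Top_noisy /mxop /revop mulmxDr.
  have -> : Top tf sys Sig Q W x0 (u k) t = adjoint_step sys Sig Q W tf (Gop sys (u k) \+ fr) t by [].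
  rewrite HE /relaxed /= SopE.
  move: (adjoint_step sys Sig Q W tf (Gop sys (u k) \+ fr) t)
    (adjoint_step sys Sig Q W tf (Gop sys (nu k w)) t)
    (adjoint_step sys Sig Q W tf (eta1 k w) t) (JN (eta2 k w) t) (u k t) (nu k w t).
  by move=> a b e f p q; apply/matrixP => i j; rewrite !mxE; ring.
have eta_so (eta : Omega -> signal R m) : measurement_noise P tf sigma eta ->
    (forall w, A w -> L2sig tf (eta w)) ->
    second_order P tf (m%:R * sigma ^+ 2) (restr A eta).
  move=> He LA; have [me _ e0 _] := He; apply: second_order_restr => //.
  by move=> t tI; exact: noise_moment He.
pose cz := sqfrob (alpha%:M : 'M[R]_m) * (2 * (CH * (m%:R * sigma ^+ 2)) +
  2 * (sqfrob N0 * 1 * (m%:R * sigma ^+ 2))).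
have Z_so k : second_order P tf cz (fun w t => alpha *: zeta k w t).
  apply: (op_so (signal_op_scale P tf m alpha)); apply: second_order_add.
    by apply: (op_so HO); apply: eta_so => // w Aw; have [] := Aw k Logic.I.
  by apply: (op_so JO); apply: eta_so => // w Aw; have [] := Aw k Logic.I.
have N00 w t : t \in `[0, tf] -> N 0%N w t = 0.
  by move=> tI; rewrite /N /restr nu0 // scaler0.
have N_so k : exists c, second_order P tf c (N k).
  elim: k => [|k [c IH]].
    exists 0; apply: second_order_eq (second_order0 P m tf_gt0) => w t tI.
    by rewrite N00.
  exists (2 * (CK * c) + 2 * cz).
  apply: second_order_eq (second_order_add (op_so KO IH) (Z_so k)) => w t tI.
  by rewrite N_rec.
have [rho rho01 [c c0 [K0 [Hen Hpt Hsplit]]]] :=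
  relaxed_pointwise P tf_gt0 sys_sym Q_psd W_pd alpha_gt0 alpha_lt.
have [b Hb] := uniform_second_moment tf_gt0 KO (sqrtmx_unit W_pd) rho01 c0 Hen Hpt
  Hsplit N00 N_rec N_so Z_so.
have nu_mean k : zero_mean P tf (nu k).
  by apply: (zero_mean_of_restr mA PA) => //; have [cn []] := N_so k.
split=> //; exists (Num.sqrt (\sum_(i < m) \sum_(j < m) (2 * b) ^+ 2)) => k t tI.
apply: (centered_covariance tI (num k) (nu_mean k)) => [|w]; last exact: ut_def.
by rewrite (moment_of_restr mA PA (num k) tI); exact: Hb.
Qed.
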